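(* Let $f:\mathbb{R}^n\to[0,\infty)$ be a strongly log-concave probability density and let $g(x)=(2\pi)^{-n/2}e^{-|x|^2/2}$ be the standard Gaussian density on $\mathbb{R}^n$. Then for every $q\in[0,\infty]$, $$h_q(f)\le h_q(g)\qquad\text{and}\qquad S_q(f)\le S_q(g),$$ where $h_q$ and $S_q$ denote the $q$-R\'enyi entropy and the $q$-Tsallis entropy.
   Context: Strongly log-concave: a probability density $f:\mathbb{R}^n\to[0,\infty)$ is strongly log-concave if there is a convex function $V:\mathbb{R}^n\to\mathbb{R}\cup\{+\infty\}$ such that $f(x)\,dx=e^{-V(x)}\gamma_n(dx)$, where $\gamma_n(dx)=(2\pi)^{-n/2}e^{-|x|^2/2}\,dx$. For a probability density $f$ on $\mathbb{R}^n$ and $q\in(0,1)\cup(1,\infty)$, $$S_q(f)=\frac{\int f^q(x)\,dx-1}{1-q},\qquad h_q(f)=\frac{\log\int f^q(x)\,dx}{1-q}.$$ For $q=1$, $S_1(f)=h_1(f)=-\int f(x)\log f(x)\,dx$ (Shannon entropy). For $q=0$, $S_0(f)=|\{f>0\}|-1$ and $h_0(f)=\log|\{f>0\}|$, where $|\cdot|$ is Lebesgue measure (values $+\infty$ allowed). For $q=\infty$, $S_\infty(f)=0$ if $\|f\|_\infty\le1$ and $S_\infty(f)=-\infty$ otherwise, and $h_\infty(f)=-\log\|f\|_\infty$. *)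

(* Defs.v *)
From HB Require Import structures.
From mathcomp Require Import all_boot all_order all_algebra.
From mathcomp Require Import all_classical all_reals all_analysis.

Set Implicit Arguments.
Unset Strict Implicit.
Unset Printing Implicit Defensive.

Import Order.TTheory GRing.Theory Num.Theory.
Import numFieldNormedType.Exports.

Local Open Scope classical_set_scope.
Local Open Scope ring_scope.

(* R^n with its Borel sigma-algebra.  The coordinates live in
   [measurableTypeR R], the copy of R on which [lebesgue_measure] is defined:
   the canonical measurable structure of R itself has another display. *)
Notation Rn R n := (n.-tuple (measurableTypeR R)).

Section lebesgue_tuple_measure.
Context {R : realType}.

Definition tcons n (p : measurableTypeR R * Rn R n) : Rn R n.+1 :=
  [tuple of p.1 :: p.2].

Lemma measurable_tcons n : measurable_fun setT (@tcons n).
Proof. exact: measurable_cons. Qed.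

(* Lebesgue measure on R^n: the point mass on R^0, and the image of
   lebesgue_measure \x (Lebesgue measure on R^m) under (a, x) |-> a :: x. *)
Fixpoint lebesgue_tuple n : set (Rn R n) -> \bar R :=
  match n with
  | 0%N => \d_([tuple] : Rn R 0)
  | m.+1 => pushforward (@lebesgue_measure R \x @lebesgue_tuple m)%E (@tcons m)
  end.

Local Open Scope ereal_scope.

Let sfm n (mu : set (Rn R n) -> \bar R) :=
  [/\ mu set0 = 0, forall A, 0 <= mu A, semi_sigma_additive mu
    & sigma_finite [set: Rn R n] mu].

Let untcons n (x : Rn R n.+1) : measurableTypeR R * Rn R n :=
  (thead x, [tuple of behead x]).

Let measurable_untcons n : measurable_fun setT (@untcons n).
Proof.
apply/measurable_fun_pairP; split; last exact: measurable_behead.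
exact: measurable_tnth.
Qed.

Let tconsK n : cancel (@tcons n) (@untcons n).
Proof. by move=> [a x]; congr pair; apply/val_inj. Qed.

Let sfm_pushforward n (m : {sigma_finite_measure set (Rn R n) -> \bar R}) :
  sfm (pushforward (@lebesgue_measure R \x m) (@tcons n)).
Proof.
pose M : {measure set _ -> \bar R} := (@lebesgue_measure R \x m).
have mP (A : set (Rn R n.+1)) : measurable A -> measurable (@tcons n @^-1` A).
  by move=> mA; rewrite -[X in measurable X]setTI; exact: measurable_tcons.
split.
- by rewrite /pushforward preimage_set0 measure0.
- by move=> A; exact: (measure_ge0 M).
- move=> F mF tF mUF; rewrite /pushforward preimage_bigcup.
  apply: (@measure_semi_sigma_additive _ _ _ M) => [k||]; first exact: mP.
  + apply/trivIsetP => /= i j _ _ ij; rewrite -preimage_setI.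
    by move/trivIsetP : tF => /(_ _ _ _ _ ij) ->//; rewrite preimage_set0.
  + by rewrite -preimage_bigcup; exact: mP.
- have /sigma_finiteP[F [TF ndF Foo]] := sigma_finiteT (@lebesgue_measure R).
  have /sigma_finiteP[G [TG ndG Goo]] := sigma_finiteT m.
  exists (fun k => @untcons n @^-1` (F k `*` G k)) => [|k].
    rewrite -preimage_bigcup -(preimage_setT (@untcons n)); congr preimage.
    rewrite -setXTT TF TG predeqE => -[x y]; split => [[/= [i _ Fx] [k _ Gy]]|].
      exists (maxn i k) => //; split.
      + by move: x Fx; exact/subsetPset/ndF/leq_maxl.
      + by move: y Gy; exact/subsetPset/ndG/leq_maxr.
    by move=> [k _ []/= ? ?]; split; exists k.
  have [mF Fy] := Foo k; have [mG Gy] := Goo k; split.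
    rewrite -[X in measurable X]setTI.
    by apply: measurable_untcons => //; exact: measurableX.
  rewrite /pushforward -comp_preimage.
  rewrite (_ : @untcons n \o @tcons n = id); last first.
    by rewrite funeqE => p /=; exact: tconsK.
  by rewrite preimage_id product_measure1E// lte_mul_pinfty// ge0_fin_numE.
Qed.

Let sfm_lebesgue_tuple n : sfm (@lebesgue_tuple n).
Proof.
elim: n => [|n [m0 mge0 msa msf]].
  pose m : {sigma_finite_measure set (Rn R 0) -> \bar R} :=
    \d_([tuple] : Rn R 0).
  split; [exact: (measure0 m) | exact: (measure_ge0 m)
         | exact: (@measure_semi_sigma_additive _ _ _ m) | exact: (sigma_finiteT m)].
pose M1 := isMeasure.Build _ _ _ (@lebesgue_tuple n) m0 mge0 msa.
pose m : {measure set (Rn R n) -> \bar R} := HB.pack (@lebesgue_tuple n) M1.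
pose M2 := Measure_isSigmaFinite.Build _ _ _ m msf.
pose m' : {sigma_finite_measure set (Rn R n) -> \bar R} :=
  HB.pack (m : set (Rn R n) -> \bar R) M1 M2.
exact: (@sfm_pushforward n m').
Qed.

Context (n : nat).

Let lebesgue_tuple0 : @lebesgue_tuple n set0 = 0.
Proof. by case: (sfm_lebesgue_tuple n). Qed.

Let lebesgue_tuple_ge0 A : 0 <= @lebesgue_tuple n A.
Proof. by case: (sfm_lebesgue_tuple n). Qed.

Let lebesgue_tuple_sigma_additive : semi_sigma_additive (@lebesgue_tuple n).
Proof. by case: (sfm_lebesgue_tuple n). Qed.

HB.instance Definition _ := isMeasure.Build _ _ _ (@lebesgue_tuple n)
  lebesgue_tuple0 lebesgue_tuple_ge0 lebesgue_tuple_sigma_additive.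

Let lebesgue_tuple_sigma_finite :
  sigma_finite [set: Rn R n] (@lebesgue_tuple n).
Proof. by case: (sfm_lebesgue_tuple n). Qed.

HB.instance Definition _ := Measure_isSigmaFinite.Build _ _ _
  (@lebesgue_tuple n) lebesgue_tuple_sigma_finite.

End lebesgue_tuple_measure.

Arguments lebesgue_tuple : clear implicits.

Section entropies.
Context {R : realType} {n : nat}.
Local Notation mu := (lebesgue_tuple R n).

Definition sqnorm (x : Rn R n) : R := \sum_(i < n) (tnth x i : R) ^+ 2.

Definition gauss_density (x : Rn R n) : R :=
  (2 * pi) `^ (- (n%:R / 2)) * expR (- (sqnorm x / 2)).

Definition probability_density (f : Rn R n -> R) : Prop :=
  [/\ measurable_fun [set: Rn R n] f, (forall x, 0 <= f x)
    & (\int[mu]_x (f x)%:E = 1)%E].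

Definition convex_comb (t : R) (x y : Rn R n) : Rn R n :=
  [tuple (t * (tnth x i : R) + (1 - t) * (tnth y i : R) : measurableTypeR R)
    | i < n].

(* At t = 0 and t = 1 the inequality is harmless, as 0 * +oo = 0 in \bar R. *)
Definition convex_potential (V : Rn R n -> \bar R) : Prop :=
  (forall x, V x != -oo%E) /\
  (forall t x y, 0 <= t <= 1 ->
    (V (convex_comb t x y) <= t%:E * V x + (1 - t)%:E * V y)%E).

(* The identity f(x) dx = e^{-V(x)} gamma_n(dx) of measures is the a.e. equality
   of their densities with respect to dx.  V is not required to be Borel: a
   convex function need not be, on the boundary of its domain. *)
Definition strongly_log_concave (f : Rn R n -> R) : Prop :=
  probability_density f /\
  exists2 V : Rn R n -> \bar R, convex_potential V &
    {ae mu, forall x, (f x)%:E = (expeR (- V x) * (gauss_density x)%:E)%E}.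

Definition shannon_entropy (f : Rn R n -> R) : \bar R :=
  (- \int[mu]_x (f x * ln (f x))%:E)%E.

(* The value at q = -oo is junk; only 0 <= q is meaningful. *)
Definition tsallis_entropy (q : \bar R) (f : Rn R n -> R) : \bar R :=
  match q with
  | q%:E =>
      if q == 0 then (mu [set x | 0 < f x]%R - 1)%E
      else if q == 1 then shannon_entropy f
      else ((\int[mu]_x (f x `^ q)%:E - 1) * ((1 - q)^-1)%:E)%E
  | +oo%E => if ('N[mu]_+oo[EFin \o f] <= 1)%E then 0%E else -oo%E
  | -oo%E => 0%E
  end.

Definition renyi_entropy (q : \bar R) (f : Rn R n -> R) : \bar R :=
  match q with
  | q%:E =>
      if q == 0 then lne (mu [set x | 0 < f x]%R)
      else if q == 1 then shannon_entropy f
      else (lne (\int[mu]_x (f x `^ q)%:E) * ((1 - q)^-1)%:E)%E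
  | +oo%E => (- lne 'N[mu]_+oo[EFin \o f])%E
  | -oo%E => 0%E
  end.

End entropies.

(* Main.v *)
(** The quantity to compare is the f-mass of the sublevel sets of f: for every
    threshold c, the integral of f over [f < c] is at most that of the standard
    Gaussian density g over [g < c].  Integrating this against the layers of a
    nonincreasing theta gives int f theta(f) <= int g theta(g), and the entropies
    correspond to theta(u) = u^(q-1) for q < 1, max(0, - ln u) for q = 1, and
    max(0, 1 - u^(q-1)) for q > 1 (recall g <= 1); for q = oo take c slightly
    above the essential supremum of f.

    In dimension 1, translate g so that f and g have the same mass on the left of
    some x.  As f/g is log-concave, [f >= g] is an interval, and f(x) < g(x) would
    make f < g on a whole half-line starting at x, contradicting the equality of
    masses there.  Hence f >= c at the points that cut off the tails of f having
    the mass of the tails [g < c], and f >= c between these points.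

    In dimension n+1, f(a, x) is the marginal F(x) times a one-dimensional
    strongly log-concave density in a, and F is strongly log-concave by the
    one-dimensional Prekopa-Leindler inequality; as g is a product, the comparison
    tensorizes by Tonelli's theorem.  *)

Require Import Defs.
From mathcomp Require Import all_boot all_order all_algebra.
From mathcomp Require Import all_classical all_reals all_analysis.
From mathcomp Require Import measurable_realfun ess_sup_inf ring lra.

Set Implicit Arguments.
Unset Strict Implicit.
Unset Printing Implicit Defensive.

Import Order.TTheory GRing.Theory Num.Theory.
Import numFieldNormedType.Exports.

Local Open Scope classical_set_scope.
Local Open Scope ring_scope.

(** * Log-concave functions on the line *)

Section real_log_concave.
Context {R : realType}.
Implicit Types (w u v : R -> R) (x y z t : R).

(** The multiplicative form lets [w] vanish: a zero value stays zero under a positive power. *)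
Definition log_concave1 w : Prop :=
  (forall x, 0 <= w x) /\
  forall t x y, 0 < t < 1 ->
    w x `^ t * w y `^ (1 - t) <= w (t * x + (1 - t) * y).

Lemma log_concave1M u v :
  log_concave1 u -> log_concave1 v -> log_concave1 (fun x => u x * v x).
Proof.
move=> [u0 uP] [v0 vP]; split=> [x|t x y t01]; first exact: mulr_ge0.
rewrite !powRM// mulrACA ler_pM// ?mulr_ge0 ?powR_ge0//; [exact: uP|exact: vP].
Qed.

Lemma log_concave1Z (c : R) u :
  0 <= c -> log_concave1 u -> log_concave1 (fun x => c * u x).
Proof.
move=> c0; apply: (@log_concave1M (cst c)); split=> // t x y t01.
by rewrite /= -powRD ?(addrC t) ?subrK ?powRr1//; apply/implyP => /eqP; lra.
Qed.

Lemma log_concave1_expR (q : R -> R) :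
  (forall t x y, 0 < t < 1 -> t * q x + (1 - t) * q y <= q (t * x + (1 - t) * y)) ->
  log_concave1 (fun x => expR (q x)).
Proof.
move=> qP; split=> [x|t x y t01]; first exact: expR_ge0.
by rewrite -!expRM -expRD ler_expR mulrC (mulrC (q y)) qP.
Qed.

(** A weighted geometric mean is at least the smaller of its two terms. *)
Lemma log_concave1_min w x y z : log_concave1 w -> x <= z <= y ->
  Num.min (w x) (w y) <= w z.
Proof.
move=> [w0 wP] /andP[].
rewrite le_eqVlt => /orP[/eqP<- _|xz]; first by rewrite ge_min lexx.
rewrite le_eqVlt => /orP[/eqP->|zy]; first by rewrite ge_min lexx orbT.
pose t := (y - z) / (y - x).
have xy : 0 < y - x by lra.
have t01 : 0 < t < 1.
  by rewrite /t divr_gt0//= ?subr_gt0// ltr_pdivrMr// mul1r; lra.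
have -> : z = t * x + (1 - t) * y by rewrite /t; field; lra.
apply: le_trans (wP _ _ _ t01).
set c := Num.min _ _.
have c0 : 0 <= c by rewrite le_min !w0.
have -> : c = c `^ t * c `^ (1 - t).
  by rewrite -powRD ?(addrC t) ?subrK ?powRr1//; apply/implyP => /eqP; lra.
have [t0 t1] := andP t01.
by rewrite ler_pM ?powR_ge0// ge0_ler_powR ?nnegrE ?subr_ge0 ?(ltW t0) ?(ltW t1) //
  /c ge_min lexx ?orbT.
Qed.

Lemma log_concave1_gt_itv w (c : R) : log_concave1 w ->
  is_interval [set x | c < w x].
Proof.
move=> wP x y /= cx cy z xzy; apply: lt_le_trans (log_concave1_min wP xzy).
by rewrite lt_min cx.
Qed.

Lemma log_concave1_measurable w : log_concave1 w -> measurable_fun setT w.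
Proof.
move=> wP; move=> mD; apply: (measurability _ (RGenOInfty.measurableE R)) => //.
move=> _ [_ [c ->] <-]; rewrite setTI.
apply: is_interval_measurable.
rewrite (_ : _ @^-1` _ = [set x | c < w x]); first exact: log_concave1_gt_itv.
by apply/seteqP; split => x /=; rewrite in_itv/= andbT.
Qed.

(* Beyond m, ln w lies below the line through its values at x0 and m. *)
Lemma log_concave1_chord w x0 m z : log_concave1 w ->
  0 < w x0 -> 0 < w m -> (m - x0) * (z - m) >= 0 -> x0 != m ->
  w z <= expR (ln (w x0) + (z - x0) / (m - x0) * (ln (w m) - ln (w x0))).
Proof.
move=> [w0 wP] wx wm h x0m.
have [->|zm] := eqVneq z m.
  by rewrite divff ?mul1r ?subr_eq0 1?eq_sym// addrC subrK lnK.
have hh : 0 < (m - x0) * (z - m).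
  by rewrite lt_def h mulf_neq0 ?subr_eq0// eq_sym.
have mx0 : m - x0 != 0 by rewrite subr_eq0 eq_sym.
(* With this [t], the point [m] is t z + (1 - t) x0, and log-concavity at [m] is solved for ln (w
   z). Positivity is read off products with [m - x0], so that [x0] may lie on either side of [m]. *)
pose t := (m - x0) / (z - x0).
have sq : 0 < (m - x0) ^+ 2 by rewrite exprn_even_gt0.
have zx0 : 0 < (m - x0) * (z - x0).
  have -> : (m - x0) * (z - x0) = (m - x0) * (z - m) + (m - x0) ^+ 2 by ring.
  lra.
have zx0' : z - x0 != 0 by move: zx0; case: eqP => // ->; rewrite mulr0 ltxx.
have tE : t = (m - x0) ^+ 2 / ((m - x0) * (z - x0)).
  by rewrite /t; field; rewrite mx0 zx0'.
have t01 : 0 < t < 1.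
  rewrite tE divr_gt0//= ltr_pdivrMr// mul1r.
  have -> : (m - x0) * (z - x0) = (m - x0) * (z - m) + (m - x0) ^+ 2 by ring.
  lra.
have /andP[t0 t1] := t01.
have [wz0|wz] := leP (w z) 0; first by apply: (le_trans wz0); exact: expR_ge0.
rewrite -[leLHS]lnK ?posrE// ler_expR.
have := wP t z x0 t01.
have -> : t * z + (1 - t) * x0 = m by rewrite /t; field.
rewrite -ler_ln ?posrE ?mulr_gt0 ?powR_gt0// lnM ?posrE ?powR_gt0// !ln_powR => hm.
have -> : (z - x0) / (m - x0) = t^-1 by rewrite /t invf_div.
rewrite -(ler_pM2l t0) mulrDr mulrA divff ?gt_eqF// mul1r.
lra.
Qed.

End real_log_concave.

(** * Gaussian weights and distribution functions *)

Section gaussian_weight.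
Context {R : realType}.
Implicit Types (w u v : R -> R) (x y z t m : R).
Local Notation leb := (@lebesgue_measure R).

Lemma normal_pdf1E m x :
  normal_pdf m 1 x = normal_peak 1 * expR (- (x - m) ^+ 2 / 2).
Proof.
by rewrite normal_pdfE ?oner_neq0//= /normal_fun expr1n.
Qed.

Lemma normal_pdf1_gt0 m x : 0 < normal_pdf m 1 x.
Proof. by rewrite normal_pdf1E mulr_gt0 ?expR_gt0// normal_peak_gt0// oner_neq0. Qed.

Lemma normal_pdf1_shift m x : normal_pdf m 1 x = normal_pdf 0 1 (x - m).
Proof. by rewrite !normal_pdf1E subr0. Qed.

(** Completing the square: an exponential tilt of the Gaussian is a multiple of a translated one. *)
Lemma normal_pdf1_tilt a b z :
  expR (a + b * z) * normal_pdf 0 1 z = expR (a + b ^+ 2 / 2) * normal_pdf b 1 z.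
Proof.
rewrite !normal_pdf1E !(mulrCA (expR _)) -!expRD; congr (_ * expR _).
by field.
Qed.

Lemma log_concave1_normal_pdf m : log_concave1 (normal_pdf m 1).
Proof.
rewrite (_ : normal_pdf m 1 = fun x => normal_peak 1 * expR (- (x - m) ^+ 2 / 2)).
  apply: log_concave1Z; first exact: normal_peak_ge0.
  apply: log_concave1_expR => t x y /andP[t0 t1].
  rewrite -subr_ge0.
  set d := (X in 0 <= X).
  have -> : d = t * (1 - t) * (x - y) ^+ 2 / 2 by rewrite /d; field.
  by rewrite mulr_ge0// mulr_ge0// ?sqr_ge0// mulr_ge0 ?subr_ge0// ltW.
by apply/funext => x; rewrite normal_pdf1E.
Qed.

(** Let [m] be the midpoint of two points where [w] is positive. The chord of ln [w] from one of
    them through [m] bounds ln [w] beyond [m], and the tilt formula turns each of the two bounds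
    into a translated Gaussian. Integrability and boundedness follow. *)
Lemma log_concave1_normal_le w : log_concave1 w ->
  exists C1 b1 C2 b2, [/\ 0 <= C1, 0 <= C2 &
    forall z, w z * normal_pdf 0 1 z <=
              C1 * normal_pdf b1 1 z + C2 * normal_pdf b2 1 z].
Proof.
move=> wP; have w0 := wP.1.
have [[x0 [x1 [x01 wx0 wx1]]]|no2] :=
  pselect (exists x0 x1, [/\ x0 < x1, 0 < w x0 & 0 < w x1]); last first.
  have [[x0 wx0]|no1] := pselect (exists x0, 0 < w x0); last first.
    exists 0, 0, 0, 0; split=> // z.
    have -> : w z = 0.
      by apply/eqP; rewrite eq_le w0 andbT leNgt; apply/negP => ?; apply: no1; exists z.
    by rewrite !mul0r addr0.
  (* The support is the single point [x0]; the constant makes the bound an equality there. *)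
  exists (w x0 * normal_pdf 0 1 x0 / normal_pdf x0 1 x0), x0, 0, 0.
  have C0 : 0 <= w x0 * normal_pdf 0 1 x0 / normal_pdf x0 1 x0.
    by rewrite mulr_ge0 ?invr_ge0 ?mulr_ge0// ltW// normal_pdf1_gt0.
  split=> // z; rewrite mul0r addr0.
  have [->|zx0] := eqVneq z x0.
    by rewrite divfK// gt_eqF// normal_pdf1_gt0.
  have -> : w z = 0.
    apply/eqP; rewrite eq_le w0 andbT leNgt; apply/negP => wz; apply: no2.
    by move: zx0; rewrite neq_lt => /orP[]?; [exists z, x0|exists x0, z].
  by rewrite mul0r mulr_ge0// ltW// normal_pdf1_gt0.
pose m := (x0 + x1) / 2.
have xm : x0 < m by rewrite /m; lra.
have mx : m < x1 by rewrite /m; lra.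
have wm : 0 < w m.
  have := @log_concave1_min _ w x0 x1 m wP.
  by rewrite (ltW xm) (ltW mx) => /(_ isT); apply: lt_le_trans; rewrite lt_min wx0.
(* [b y] and [a y] are the slope and the intercept of the chord of ln [w] through [y] and [m]. *)
pose b y := (ln (w m) - ln (w y)) / (m - y).
pose a y := ln (w y) - y * b y.
have chord y z : 0 < w y -> y != m -> 0 <= (m - y) * (z - m) ->
    w z * normal_pdf 0 1 z <= expR (a y + b y ^+ 2 / 2) * normal_pdf (b y) 1 z.
  move=> wy ym h.
  rewrite -normal_pdf1_tilt ler_pM2r ?normal_pdf1_gt0//.
  apply: le_trans (log_concave1_chord wP wy wm h ym) _.
  rewrite ler_expR /a /b le_eqVlt; apply/orP; left; apply/eqP.
  by field; rewrite subr_eq0 eq_sym.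
exists (expR (a x0 + b x0 ^+ 2 / 2)), (b x0), (expR (a x1 + b x1 ^+ 2 / 2)), (b x1).
split; rewrite ?expR_ge0// => z.
have [mz|zm] := leP m z.
  apply: le_trans (chord x0 z wx0 _ _) _; first by rewrite lt_eqF.
    by rewrite mulr_ge0 ?subr_ge0// ltW.
  by rewrite lerDl mulr_ge0 ?expR_ge0// ltW// normal_pdf1_gt0.
apply: le_trans (chord x1 z wx1 _ _) _; first by rewrite gt_eqF.
  by rewrite mulr_le0 ?subr_le0// ltW.
by rewrite lerDr mulr_ge0 ?expR_ge0// ltW// normal_pdf1_gt0.
Qed.

Lemma log_concave1_normal_measurable w : log_concave1 w ->
  measurable_fun setT (fun z => w z * normal_pdf 0 1 z).
Proof.
move=> wP; apply: measurable_funM; first exact: log_concave1_measurable.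
exact: measurable_normal_pdf.
Qed.

Lemma log_concave1_normal_integrable w : log_concave1 w ->
  leb.-integrable setT (fun z => (w z * normal_pdf 0 1 z)%:E).
Proof.
move=> wP; have [C1 [b1 [C2 [b2 [C10 C20 le]]]]] := log_concave1_normal_le wP.
apply: (@le_integrable _ _ _ leb setT measurableT _
    (fun z => C1%:E * (normal_pdf b1 1 z)%:E + C2%:E * (normal_pdf b2 1 z)%:E)%E).
- by apply/measurable_EFinP; exact: log_concave1_normal_measurable.
- move=> z _; rewrite -!EFinM -EFinD !abse_EFin lee_fin.
  rewrite !ger0_norm ?le//.
    by rewrite addr_ge0// mulr_ge0// normal_pdf_ge0.
  by rewrite mulr_ge0 ?normal_pdf_ge0// wP.1.
- by apply: integrableD => //; apply: integrableZl => //; exact: integrable_normal_pdf.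
Qed.

Lemma log_concave1_normal_bounded w : log_concave1 w ->
  exists M, forall z, w z * normal_pdf 0 1 z <= M.
Proof.
move=> wP; have [C1 [b1 [C2 [b2 [C10 C20 le]]]]] := log_concave1_normal_le wP.
exists (C1 * normal_peak 1 + C2 * normal_peak 1) => z; apply: le_trans (le z) _.
by rewrite lerD// ler_wpM2l// normal_pdf_ub// oner_neq0.
Qed.

End gaussian_weight.

(** * Quantiles of a bounded density *)

Section distribution_function.
Context {R : realType}.
Local Notation leb := (@lebesgue_measure R).
Local Open Scope ereal_scope.

(* The bound M makes the distribution function Lipschitz, so that the
   intermediate value theorem applies. *)
Lemma bounded_density_quantile (k : R -> R) (M p : R) :
  measurable_fun setT k -> (forall x, 0 <= k x)%R -> (forall x, k x <= M)%R ->
  \int[leb]_x (k x)%:E = 1 -> (0 < p < 1)%R ->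
  exists x, \int[leb]_(z in `]-oo, x]) (k z)%:E = p%:E.
Proof.
move=> mk k0 kM k1 /andP[p0 p1].
have mkE D : measurable_fun D (EFin \o k).
  by apply/measurable_EFinP; exact: measurable_funTS.
have kE0 x : 0 <= (k x)%:E by rewrite lee_fin.
have M0 : (0 <= M)%R := le_trans (k0 0%R) (kM 0%R).
pose G x := \int[leb]_(z in `]-oo, x]) (k z)%:E.
have G0 x : 0 <= G x by apply: integral_ge0.
have G1 x : G x <= 1.
  by rewrite -k1; apply: ge0_subset_integral => //; exact: mkE.
have Gfin x : G x \is a fin_num.
  by rewrite ge0_fin_numE// (le_lt_trans (G1 x))// ltry.
have GB x y : (x <= y)%R -> G y <= G x + (M * (y - x))%:E.
  move=> xy.
  have -> : G y = G x + \int[leb]_(z in `]x, y]) (k z)%:E.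
    rewrite /G (@itv_bndbnd_setU _ _ -oo%O (BRight x) (BRight y))//.
    rewrite ge0_integral_setU//; first exact: mkE.
    apply/disj_setPRL => z/=; rewrite !in_itv/= => /andP[xz _].
    by apply/negP; rewrite -ltNge.
  rewrite leeD2l//.
  apply: (@le_trans _ _ (\int[leb]_(z in `]x, y]) (cst M%:E z))).
    by apply: ge0_le_integral => //; [exact: mkE| move=> z _; rewrite lee_fin].
  rewrite integral_cst//= lebesgue_measure_itv/= lte_fin.
  by case: ltP => // ?; rewrite ?mule0 ?lee_fin ?mulr_ge0 ?subr_ge0.
have Gnd x y : (x <= y)%R -> G x <= G y.
  move=> xy; apply: ge0_subset_integral => //; first exact: mkE.
  by move=> z/=; rewrite !in_itv/= => /le_trans; exact.
have top : exists x, (p < fine (G x))%R.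
  pose F (i : nat) : set (measurableTypeR R) := [set` `]-oo, i%:R]].
  have FT : \bigcup_i F i = setT.
    apply/seteqP; split=> // z _; exists (Num.truncn `|z|%R).+1 => //.
    by rewrite /F/= in_itv/= (le_trans (ler_norm z))// ltW// ?truncnS_gt.
  have : \int[leb]_(z in F i) (k z)%:E @[i --> \oo] --> \int[leb]_z (k z)%:E.
    rewrite -FT.
    apply: (@ge0_nondecreasing_set_cvg_integral _ (measurableTypeR R) R F
      (EFin \o k) leb) => //.
    - apply/nondecreasing_seqP => n; rewrite subsetEset => z /=.
      by rewrite /F/= !in_itv/= => /le_trans; apply; rewrite ler_nat.
    - by move=> i; rewrite /F; exact: measurable_itv.
    - by move=> i; exact: mkE.
    - by move=> i x _; exact: kE0.
  rewrite k1 => cG; apply: contrapT => /forallNP Gp.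
  have : (1 <= p%:E); last by rewrite lee_fin leNgt p1.
  apply: (cvge_le _ cG); near=> N.
  by rewrite -[leLHS](fineK (Gfin _)) lee_fin leNgt; exact/negP.
(* If every lower tail had mass at least [p], the complementary upper tails [F N] would have mass at
   most 1 - p, yet their masses converge to 1. *)
have bot : exists x, (fine (G x) < p)%R.
  pose F (i : nat) : set (measurableTypeR R) := [set` `](- i%:R)%R, +oo[].
  have FT : \bigcup_i F i = setT.
    apply/seteqP; split=> // z _; exists (Num.truncn `|z|%R).+1 => //.
    by rewrite /F/= in_itv/= andbT ltrNl (le_lt_trans (ler_norm _))// normrN ?truncnS_gt.
  have : \int[leb]_(z in F i) (k z)%:E @[i --> \oo] --> \int[leb]_z (k z)%:E.
    rewrite -FT.
    apply: (@ge0_nondecreasing_set_cvg_integral _ (measurableTypeR R) R F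
      (EFin \o k) leb) => //.
    - apply/nondecreasing_seqP => n; rewrite subsetEset => z /=.
      rewrite /F/= !in_itv/= !andbT => /le_lt_trans; apply.
      by rewrite lerN2 ler_nat.
    - by move=> i; rewrite /F; exact: measurable_itv.
    - by move=> i; exact: mkE.
    - by move=> i x _; exact: kE0.
  rewrite k1 => cG; apply: contrapT => /forallNP Gp.
  have : (1 <= (1 - p)%:E); last by rewrite lee_fin; lra.
  apply: (cvge_le _ cG); near=> N.
  have {Gp} pG : p%:E <= G (- N%:R)%R.
    by rewrite -[leRHS](fineK (Gfin _)) lee_fin leNgt; exact/negP.
  have : G (- N%:R)%R + \int[leb]_(z in F N) (k z)%:E = 1.
    have FN : [set: measurableTypeR R] = `]-oo, (- N%:R)%R] `|` F N.
      apply/seteqP; split=> // z _.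
      rewrite /F/= !in_itv/= andbT.
      by case: (leP z (- N%:R)%R) => ?; [left|right].
    rewrite -k1 FN ge0_integral_setU//.
    - by rewrite /F; exact: measurable_itv.
    - exact: mkE.
    - apply/disj_setPRL => z/=; rewrite /F/= !in_itv/= => /andP[xz _].
      by apply/negP; rewrite -ltNge.
  move: pG.
  have := G0 (- N%:R)%R; have := Gfin (- N%:R)%R.
  case: (G _) => // g _.
  case: (integral _ _ _) => [r| |] //; rewrite ?lee_fin => _ pr [].
  lra.
have [a pa] := bot; have [b pb] := top.
have fG_nd : {homo (fine \o G) : x y / (x <= y)%R}.
  by move=> x y xy /=; rewrite fine_le//; exact: Gnd.
have ab : (a <= b)%R.
  rewrite leNgt; apply/negP => /ltW/fG_nd/= ba.
  by have := lt_trans pa pb; rewrite ltNge ba.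
have fGB x y : (x <= y -> fine (G y) <= fine (G x) + M * (y - x))%R.
  move=> xy; rewrite -lee_fin EFinD !fineK//; exact: GB.
have cG : continuous (fine \o G).
  move=> x; apply/cvgrPdist_lt => e e0.
  near=> y.
  have close : (`|x - y| < e / (M + 1))%R.
    by near: y; apply: (@nbhsx_ballx _ R^o x); rewrite divr_gt0 ?ltr_wpDl.
  have Me : (M * `|x - y| < e)%R.
    rewrite (le_lt_trans (y := ((M + 1) * `|x - y|)%R))//.
      by rewrite ler_wpM2r// lerDl.
    by rewrite mulrC -ltr_pdivlMr// ltr_wpDl.
  apply: le_lt_trans Me => /=.
  have [xy|yx] := leP x y.
    have := fG_nd _ _ xy; have := fGB _ _ xy => /= h1 h2.
    by rewrite distrC ger0_norm ?subr_ge0// distrC ger0_norm ?subr_ge0// lerBlDl.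
  have := fG_nd _ _ (ltW yx); have := fGB _ _ (ltW yx) => /= h1 h2.
  by rewrite ger0_norm ?subr_ge0// ger0_norm ?subr_ge0 ?(ltW yx)// lerBlDl.
have [||x _ xp] := @IVT R (fine \o G) a b p ab.
- by apply: continuous_subspaceT => x; exact: cG.
- by rewrite /= ge_min le_max (ltW pa) (ltW pb) orbT.
by exists x; rewrite -[LHS](fineK (Gfin x)) -xp.
Unshelve. all: by end_near. Qed.

End distribution_function.

(** * The one-dimensional comparison *)

Section strict_integral.
Context {d} {T : measurableType d} {R : realType}.
Variable mu : {measure set T -> \bar R}.
Local Open Scope ereal_scope.

(** If the integrals agreed, the positive function [g - f] would have integral zero on [D], hence
    vanish almost everywhere there, although [D] has positive measure. Finiteness justifies the
    subtraction. *)
Lemma ge0_lt_integral_neq (D : set T) (f g : T -> R) : measurable D ->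
  measurable_fun D f -> measurable_fun D g -> 0 < mu D ->
  (forall x, D x -> 0 <= f x < g x)%R -> \int[mu]_(x in D) (g x)%:E < +oo ->
  \int[mu]_(x in D) (f x)%:E != \int[mu]_(x in D) (g x)%:E.
Proof.
move=> mD mf mg D0 fg gfin; apply/eqP => fgE.
have dP x : D x -> 0 <= (g x - f x)%:E.
  by move=> /fg /andP[_ /ltW]; rewrite lee_fin subr_ge0.
have md : measurable_fun D (fun x => (g x - f x)%:E).
  by apply/measurable_EFinP; exact: measurable_funB.
have f0 x : D x -> 0 <= (f x)%:E by move=> /fg /andP[].
have h : \int[mu]_(x in D) (g x)%:E =
    \int[mu]_(x in D) (f x)%:E + \int[mu]_(x in D) (g x - f x)%:E.
  rewrite -ge0_integralD//; last exact/measurable_EFinP.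
  by apply: eq_integral => x _; rewrite -EFinD addrC subrK.
have Ig : \int[mu]_(x in D) (g x)%:E \is a fin_num.
  rewrite ge0_fin_numE// integral_ge0// => x /fg /andP[h1 /ltW h2].
  by rewrite lee_fin (le_trans h1).
have d0 : \int[mu]_(x in D) (g x - f x)%:E = 0.
  move: h Ig; rewrite fgE.
  case: (\int[mu]_(x in D) (g x)%:E) => // r.
  case: (integral _ _ _) => [s| |] // [rs] _.
  by congr EFin; lra.
have [N [mN N0 DN]] : ae_eq mu D (fun x => (g x - f x)%:E) (cst 0).
  apply/ae_eq_integral_abs => //; rewrite -[RHS]d0.
  by apply: eq_integral => x /[!inE] Dx; rewrite gee0_abs// dP.
have : mu D <= mu N.
  apply: le_measure; rewrite ?inE// => x Dx; apply: DN => /= /(_ Dx) [] /eqP.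
  by rewrite subr_eq0 gt_eqF//; have /andP[] := fg _ Dx.
by rewrite N0 leNgt D0.
Qed.

End strict_integral.

(** * Masses of sublevel sets on the line *)

Section gaussian_comparison.
Context {R : realType}.
Implicit Types (w : R -> R) (x y z t m c u : R).
Local Notation leb := (@lebesgue_measure R).
Local Notation gam := (@normal_pdf R 0 1).

(** For a density h, the integral of [below c (h x)] is the h-mass of [h < c]. *)
Definition below c u : R := if u < c then u else 0.

Lemma below_ge0 c u : 0 <= u -> 0 <= below c u.
Proof. by rewrite /below; case: ifP. Qed.

Lemma below_le c u : 0 <= u -> below c u <= u.
Proof. by rewrite /below; case: ifP. Qed.

(** A positive factor comes out at the cost of rescaling the threshold; the normalization of slices
    and the induction on the dimension rest on this. *)
Lemma belowM a c u : 0 < a -> below c (a * u) = a * below (c / a) u.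
Proof.
by move=> a0; rewrite /below ltr_pdivlMr// (mulrC u); case: ifP; rewrite ?mulr0.
Qed.

Lemma measurable_below c : measurable_fun setT (below c).
Proof.
apply: measurable_fun_ifT => //; exact: measurable_fun_ltr.
Qed.

Lemma density_upper_tail (h : R -> R) x : measurable_fun setT h ->
  (forall z, 0 <= h z) -> (\int[leb]_z (h z)%:E = 1)%E ->
  (\int[leb]_(z in `]x, +oo[) (h z)%:E =
   1 - \int[leb]_(z in `]-oo, x]) (h z)%:E)%E.
Proof.
move=> mh h0 h1.
have TE : [set: measurableTypeR R] = `]-oo, x] `|` `]x, +oo[.
  apply/seteqP; split=> // z _ /=; rewrite !in_itv/= andbT.
  by case: (leP z x) => ?; [left|right].
have : (\int[leb]_(z in `]-oo, x]) (h z)%:E +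
    \int[leb]_(z in `]x, +oo[) (h z)%:E = 1)%E.
  rewrite -h1 TE ge0_integral_setU//.
  - by apply/measurable_EFinP; exact: measurable_funTS.
  - by move=> z _; rewrite lee_fin.
  - apply/disj_setPRL => z/=; rewrite !in_itv/= => /andP[xz _].
    by apply/negP; rewrite -ltNge.
have : (0 <= \int[leb]_(z in `]-oo, x]) (h z)%:E)%E.
  by apply: integral_ge0 => z _; rewrite lee_fin.
have : (0 <= \int[leb]_(z in `]x, +oo[) (h z)%:E)%E.
  by apply: integral_ge0 => z _; rewrite lee_fin.
move: (\int[leb]_(z in `]x, +oo[) (h z)%:E)%E (\int[leb]_(z in `]-oo, x]) (h z)%:E)%E.
move=> [r| |] [s| |]// _ _ [sr].
by rewrite -EFinB; congr EFin; lra.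
Qed.

Lemma normal_cdf_shift x y :
  (\int[leb]_(z in `]-oo, x]) (normal_pdf (x - y) 1 z)%:E =
   \int[leb]_(z in `]-oo, y]) (gam z)%:E)%E.
Proof.
pose F z := z - (x - y).
have F'1 : F^`()%classic = cst 1.
  by apply/funext => z; rewrite derive1E /F deriveB// derive_id derive_cst subr0.
have Fx : F x = y by rewrite /F; lra.
rewrite -[in RHS]Fx (@increasing_ge0_integration_by_substitutionNy _ F gam).
- apply: eq_integral => z _; rewrite F'1 /= mulr1 /F.
  by rewrite [in LHS]normal_pdf1_shift.
- by move=> a b _ _ ab; rewrite /F ltrD2r.
- by rewrite F'1 => z _; exact: cst_continuous.
- by rewrite F'1; exact: is_cvg_cst.
- by rewrite F'1; exact: cvg_cst.
- split => //.
  by apply: cvg_at_left_filter; apply: cvgB; [exact: cvg_id|exact: cvg_cst].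
- exact: cvg_addrr_Ny.
- apply: continuous_subspaceT => z; apply: continuous_normal_pdf; exact: oner_neq0.
- by move=> z _; exact: normal_pdf_ge0.
Qed.

Lemma normal_lower_tail_gt0 y : (0 < \int[leb]_(z in `]-oo, y]) (gam z)%:E)%E.
Proof.
have mg (D : set (measurableTypeR R)) : measurable_fun D (EFin \o gam).
  by apply/measurable_EFinP/measurable_funTS; exact: measurable_normal_pdf.
rewrite lt_neqAle eq_sym; apply/andP; split; last first.
  by apply: integral_ge0 => z _; rewrite lee_fin normal_pdf_ge0.
rewrite eq_sym -(integral0 leb `]-oo, y]).
apply: (@ge0_lt_integral_neq _ _ _ leb `]-oo, y] (fun=> 0%R) gam) => //.
- exact/measurable_EFinP.
- by rewrite [ltRHS]lebesgue_measure_itv/= ?ltNyr ?ltry.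
- by move=> z _; rewrite lexx normal_pdf1_gt0.
- rewrite (@le_lt_trans _ _ 1%E)// ?ltry//.
  rewrite -(integral_normal_pdf 0 1); apply: ge0_subset_integral => //.
  by move=> z _; rewrite lee_fin normal_pdf_ge0.
Qed.

Lemma normal_upper_tail y : (\int[leb]_(z in `[y, +oo[) (gam z)%:E =
  \int[leb]_(z in `]-oo, (- y)%R]) (gam z)%:E)%E.
Proof.
rewrite ge0_integration_by_substitutionNy.
- by apply: eq_integral => z _ /=; rewrite !normal_pdf1E !subr0 sqrrN.
- apply: continuous_subspaceT => z; apply: continuous_normal_pdf; exact: oner_neq0.
- by move=> z _; exact: normal_pdf_ge0.
Qed.

Section density.
Variable w : R -> R.
Hypothesis wP : log_concave1 w.
Let k z := w z * gam z.

Let k0 z : 0 <= k z.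
Proof. by rewrite mulr_ge0 ?normal_pdf_ge0// wP.1. Qed.

Let mk : measurable_fun setT k.
Proof. exact: log_concave1_normal_measurable. Qed.

Lemma log_concave1_normal_above m x y z :
  normal_pdf m 1 x <= k x -> normal_pdf m 1 y <= k y -> x <= z <= y ->
  normal_pdf m 1 z <= k z.
Proof.
(* [u] is the log-concave ratio [k / normal_pdf m 1]. *)
pose u s := w s * expR (m ^+ 2 / 2 - m * s).
have uP : log_concave1 u.
  apply: log_concave1M => //; apply: log_concave1_expR => t a b _.
  by rewrite le_eqVlt; apply/orP; left; apply/eqP; ring.
have kE s : k s = u s * normal_pdf m 1 s.
  rewrite /k /u !normal_pdf1E -mulrA; congr (_ * _).
  by rewrite mulrCA -expRD; congr (_ * expR _); field.
have uk s : (normal_pdf m 1 s <= k s) = (1 <= u s).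
  by rewrite kE ler_pMl// normal_pdf1_gt0.
rewrite !uk => hx hy /(log_concave1_min uP); apply: le_trans.
by rewrite le_min hx.
Qed.

Hypothesis k1 : (\int[leb]_z (k z)%:E = 1)%E.

(* In other words, the isoperimetric profile of k dominates that of the Gaussian. *)
Lemma normal_profile_le x y :
  (\int[leb]_(z in `]-oo, x]) (k z)%:E = \int[leb]_(z in `]-oo, y]) (gam z)%:E)%E ->
  gam y <= k x.
Proof.
(* The Gaussian centred at [m] has the same mass as [k] on the left of [x], and takes the value
   [gam y] at [x]. *)
rewrite -(normal_cdf_shift x) => E; set m := x - y in E.
have gE : gam y = normal_pdf m 1 x.
  by rewrite (normal_pdf1_shift m) /m opprB addrC subrK.
rewrite gE leNgt; apply/negP => kx.
have mkD (D : set (measurableTypeR R)) : measurable_fun D k by exact: measurable_funTS.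
have mgD (D : set (measurableTypeR R)) : measurable_fun D (normal_pdf m 1).
  by apply: measurable_funTS; exact: measurable_normal_pdf.
have gfin (D : set (measurableTypeR R)) : measurable D ->
    (\int[leb]_(z in D) (normal_pdf m 1 z)%:E < +oo)%E.
  move=> mD; apply: (@le_lt_trans _ _ 1%E); last by rewrite ltry.
  rewrite -(integral_normal_pdf m 1); apply: ge0_subset_integral => //.
    by apply/measurable_EFinP; exact: mgD.
  by move=> z _; rewrite lee_fin normal_pdf_ge0.
(* If [k] stays below the translate on a whole side of [x], the masses on that side cannot agree.
   Otherwise [k] reaches the translate on both sides of [x], hence also at [x]. *)
have [ltl|] := pselect (forall z, z <= x -> k z < normal_pdf m 1 z).
  move/eqP: E; apply/negP; apply: ge0_lt_integral_neq => //.
  - by rewrite [ltRHS]lebesgue_measure_itv/= ?ltNyr ?ltry.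
  - by move=> z /=; rewrite in_itv/= k0 => /ltl.
  - exact: gfin.
move=> /existsNP[z1 /not_implyP[z1x /negP]]; rewrite -leNgt => kz1.
have [ltr|] := pselect (forall z, x < z -> k z < normal_pdf m 1 z); last first.
  move=> /existsNP[z2 /not_implyP[xz2 /negP]]; rewrite -leNgt => kz2.
  have := @log_concave1_normal_above m z1 z2 x kz1 kz2.
  by rewrite z1x (ltW xz2) leNgt kx => /(_ isT).
have E' : (\int[leb]_(z in `]x, +oo[) (k z)%:E =
           \int[leb]_(z in `]x, +oo[) (normal_pdf m 1 z)%:E)%E.
  rewrite !density_upper_tail ?E//.
  - exact: measurable_normal_pdf.
  - by move=> z; exact: normal_pdf_ge0.
  - exact: integral_normal_pdf.
move/eqP: E'; apply/negP; apply: ge0_lt_integral_neq => //.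
- by rewrite [ltRHS]lebesgue_measure_itv/= ?ltNyr ?ltry.
- by move=> z /=; rewrite in_itv/= k0 andbT => /ltr.
- exact: gfin.
Qed.

Local Open Scope ereal_scope.

(** In the main case [gam < c] consists of two tails of mass [P] each. By [normal_profile_le], [k]
    is at least [c] at the quantiles cutting off two tails of [k] of mass [P], hence between them,
    so [k < c] lies in these tails. *)
Lemma integral_below_normal_le c :
  \int[leb]_z (below c (k z))%:E <= \int[leb]_z (below c (gam z))%:E.
Proof.
have mk' (D : set (measurableTypeR R)) : measurable_fun D (EFin \o k).
  by apply/measurable_EFinP; exact: measurable_funTS.
have mg (D : set (measurableTypeR R)) : measurable_fun D (EFin \o gam).
  by apply/measurable_EFinP/measurable_funTS; exact: measurable_normal_pdf.
have mbk : measurable_fun setT (fun z => (below c (k z))%:E).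
  by apply/measurable_EFinP; apply: measurableT_comp => //; exact: measurable_below.
have mbg : measurable_fun setT (fun z => (below c (gam z))%:E).
  apply/measurable_EFinP; apply: measurableT_comp; first exact: measurable_below.
  exact: measurable_normal_pdf.
have g0 z : (0 <= gam z)%R by exact: normal_pdf_ge0.
have [c0|c0] := leP c 0%R.
  rewrite (eq_integral (cst 0)); last first.
    by move=> z _; rewrite /below ltNge (le_trans c0).
  by rewrite integral0; apply: integral_ge0 => z _; rewrite lee_fin below_ge0.
(* Above the peak, [gam < c] is the whole line and the right side equals 1. *)
have [cp|cp] := leP c (@normal_peak R 1); last first.
  apply: (@le_trans _ _ (\int[leb]_z (k z)%:E)).
    apply: ge0_le_integral => //; first by move=> z _; rewrite lee_fin below_ge0.
    by move=> z _; rewrite lee_fin below_le.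
  rewrite k1 -(integral_normal_pdf 0 1) le_eqVlt; apply/orP; left; apply/eqP.
  apply: eq_integral => z _; rewrite /below.
  by rewrite (le_lt_trans _ cp)// normal_pdf_ub// oner_neq0.
have peak0 : (0 < @normal_peak R 1)%R by rewrite normal_peak_gt0// oner_neq0.
(* The nonnegative solution of gam y = c; the logarithm is at most 0 since [c] does not exceed the
   peak. *)
pose y := Num.sqrt (- 2 * ln (c / normal_peak 1)).
have y0 : (0 <= y)%R by exact: sqrtr_ge0.
have yy : (y ^+ 2 = - 2 * ln (c / normal_peak 1))%R.
  rewrite sqr_sqrtr// mulNr oppr_ge0 pmulr_rle0// ln_le0// ler_pdivrMr// mul1r//.
have gy z : (z ^+ 2 = y ^+ 2)%R -> gam z = c.
  move=> zy; rewrite normal_pdf1E subr0 zy yy.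
  have -> : (- (- 2 * ln (c / normal_peak 1)) / 2 = ln (c / normal_peak 1))%R by field.
  by rewrite lnK ?posrE ?divr_gt0// mulrC divfK// gt_eqF.
have gz z : (y ^+ 2 < z ^+ 2)%R -> (gam z < c)%R.
  move=> yz; rewrite -(gy y)// !normal_pdf1E !subr0 ltr_pM2l// ltr_expR.
  by rewrite ltr_pM2r// ltrN2.
pose P := \int[leb]_(z in `]-oo, (- y)%R]) (gam z)%:E.
have tails : P + P <= \int[leb]_z (below c (gam z))%:E.
  rewrite {2}/P -normal_upper_tail.
  (* The endpoints are dropped because [gam] equals [c] there, while [below c] keeps only values
     strictly under [c]. *)
  rewrite /P -integral_itv_bndo_bndc; last exact: mg.
  rewrite -integral_itv_obnd_cbnd; last exact: mg.
  rewrite -ge0_integral_setU//; first last.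
  - apply/disj_setPRL => z/=; rewrite !in_itv/= andbT => yz.
    by apply/negP; rewrite -leNgt; lra.
  - by move=> z _; rewrite lee_fin.
  set D := (X in \int[leb]_(z in X) _).
  have mD : measurable D by apply: measurableU; exact: measurable_itv.
  apply: (@le_trans _ _ (\int[leb]_(z in D) (below c (gam z))%:E)).
    apply: ge0_le_integral => //.
    - by move=> z _; rewrite lee_fin.
    - exact: measurable_funTS.
    move=> z; rewrite /D/= !in_itv/= andbT => zy.
    rewrite lee_fin /below gz//; case: zy => zy.
      by rewrite -(sqrrN z) ltr_pXn2r ?nnegrE//; lra.
    by rewrite ltr_pXn2r ?nnegrE//; lra.
  apply: ge0_subset_integral => //.
  by move=> z _; rewrite lee_fin below_ge0.
have P0 : 0 < P by exact: normal_lower_tail_gt0.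
have P1 : P + P <= 1.
  apply: (le_trans tails); rewrite -(integral_normal_pdf 0 1).
  apply: ge0_le_integral => //; first by move=> z _; rewrite lee_fin below_ge0.
  by move=> z _; rewrite lee_fin below_le.
have [p pE] : exists p, P = p%:E.
  by case: (P) P0 P1 => [p| |]// _ _; exists p.
have [M kM] := log_concave1_normal_bounded wP.
move: P0 P1; rewrite pE lte_fin -EFinD lee_fin => p0 p1.
have [x1 x1E] : exists x, \int[leb]_(z in `]-oo, x]) (k z)%:E = p%:E.
  by apply: (bounded_density_quantile mk k0 kM k1); lra.
have [x2 x2E] : exists x, \int[leb]_(z in `]-oo, x]) (k z)%:E = (1 - p)%:E.
  by apply: (bounded_density_quantile mk k0 kM k1); lra.
have kx1 : (c <= k x1)%R.
  by rewrite -(gy (- y)%R) ?sqrrN//; apply: normal_profile_le; rewrite x1E -pE.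
(* By symmetry [y] leaves mass [p] on its right, so it is the Gaussian quantile of the same order as
   [x2]. *)
have kx2 : (c <= k x2)%R.
  rewrite -(gy y)//; apply: normal_profile_le; rewrite x2E.
  have := @density_upper_tail gam y (@measurable_normal_pdf R 0 1) g0
    (integral_normal_pdf 0 1).
  rewrite integral_itv_obnd_cbnd ?normal_upper_tail -/P ?pE; last exact: mg.
  by case: (\int[leb]_(z in `]-oo, y]) (gam z)%:E) => // r [->]; congr EFin; lra.
apply: le_trans tails; rewrite {1}pE -x1E.
have -> : P = \int[leb]_(z in `]x2, +oo[) (k z)%:E.
  by rewrite density_upper_tail// x2E pE -EFinB; congr EFin; lra.
(* The two restrictions are added rather than merged into one domain, so the bound holds whatever
   the order of [x1] and [x2]. *)
rewrite [X in _ <= X + _]integral_mkcond [X in _ <= _ + X]integral_mkcond.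
have mres (D : set (measurableTypeR R)) : measurable D ->
    measurable_fun setT ((EFin \o k) \_ D).
  by move=> mD; apply/(measurable_restrictT _ mD); exact: mk'.
have res0 (D : set (measurableTypeR R)) z : 0 <= ((EFin \o k) \_ D) z.
  by apply: erestrict_ge0 => {}z _; rewrite lee_fin.
rewrite -ge0_integralD//; first last.
- by apply: mres; exact: measurable_itv.
- by apply: mres; exact: measurable_itv.
apply: ge0_le_integral => //.
- by move=> z _; rewrite lee_fin below_ge0.
- by apply: emeasurable_funD; apply: mres; exact: measurable_itv.
move=> z _; rewrite !patchE.
case: ifPn => [_|].
  rewrite -[leLHS]adde0 leeD//; first by rewrite lee_fin below_le.
  by case: ifP => _ //=; rewrite lee_fin.
rewrite notin_setE/= in_itv/= => /negP; rewrite -ltNge => x1z.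
case: ifPn => [_|]; first by rewrite add0e lee_fin below_le.
rewrite notin_setE/= in_itv/= andbT => /negP; rewrite -leNgt => zx2.
rewrite adde0 lee_fin /below ltNge.
have := @log_concave1_min _ _ x1 x2 z (log_concave1M wP (log_concave1_normal_pdf 0)).
rewrite (ltW x1z) zx2 => /(_ isT); rewrite -/(k _) -/(k _) -/(k _) => kz.
by rewrite (le_trans _ kz)// le_min kx1.
Qed.

End density.
End gaussian_comparison.

(** * The Prekopa-Leindler inequality on the line *)

Section layer_cake.
Context {d} {T : measurableType d} {R : realType}.
Variable mu : {sigma_finite_measure set T -> \bar R}.
Local Notation leb := (@lebesgue_measure R).
Local Open Scope ereal_scope.

(** Tonelli's theorem, once [h x] is written as the length of [0, h x[. The weight [w] is 1 for the
    Prekopa-Leindler inequality and the density itself for the entropies. *)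
Lemma weighted_layer_cake (w h : T -> R) :
  measurable_fun setT w -> measurable_fun setT h ->
  (forall x, 0 <= w x)%R -> (forall x, 0 <= h x)%R ->
  \int[mu]_x (w x * h x)%:E =
  \int[leb]_(s in `[0%R, +oo[) \int[mu]_x (if (s < h x)%R then w x else 0%R)%:E.
Proof.
move=> mw mh w0 h0.
pose F (p : T * measurableTypeR R) : \bar R :=
  (if ((0 <= p.2) && (p.2 < h p.1))%R then w p.1 else 0%R)%:E.
have mF : measurable_fun setT F.
  apply/measurable_EFinP; apply: measurable_fun_ifT => //.
    apply: measurable_and; first exact: measurable_fun_ler.
    by apply: measurable_fun_ltr => //; exact: measurableT_comp.
  exact: measurableT_comp.
have F0 p : 0 <= F p by rewrite /F; case: ifP => //; rewrite lee_fin.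
transitivity (\int[mu]_x \int[leb]_s F (x, s)).
  apply: eq_integral => x _.
  transitivity (\int[leb]_s ((w x)%:E * (\1_`[0%R, h x[ s)%:E)); last first.
    apply: eq_integral => s _; rewrite /F/= indicE -EFinM; congr EFin.
    case: ifPn => [sh|sh]; first by rewrite mem_set ?mulr1//= in_itv.
    by rewrite memNset ?mulr0//= in_itv/=; exact/negP.
  rewrite ge0_integralZl_EFin//; last exact/measurable_EFinP.
  rewrite integral_indic//= setIT lebesgue_measure_itv/= lte_fin EFinM.
  by rewrite oppr0 adde0; case: ltgtP (h0 x) => // <-.
rewrite (fubini_tonelli F mF F0) [RHS]integral_mkcond.
apply: eq_integral => s _; rewrite patchE.
case: ifPn => [|].
  rewrite inE/= in_itv/= andbT => s0.
  by apply: eq_integral => x _; rewrite /F/= s0.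
rewrite notin_setE/= in_itv/= andbT => /negP s0.
by apply: integral0_eq => x _; rewrite /F/= (negbTE s0).
Qed.

Lemma measurable_layer (w h : T -> R) :
  measurable_fun setT w -> measurable_fun setT h -> (forall x, 0 <= w x)%R ->
  measurable_fun setT
    (fun s : measurableTypeR R => \int[mu]_x (if (s < h x)%R then w x else 0%R)%:E).
Proof.
move=> mw mh w0.
apply: (measurable_fun_fubini_tonelli_G
  (fun p : T * measurableTypeR R => (if (p.2 < h p.1)%R then w p.1 else 0%R)%:E)).
- apply/measurable_EFinP; apply: measurable_fun_ifT => //.
    by apply: measurable_fun_ltr => //; exact: measurableT_comp.
  exact: measurableT_comp.
- by move=> p; case: ifP => //; rewrite lee_fin.
Qed.

End layer_cake.

(** Young's inequality with conjugate exponents 1/t and 1/(1 - t), applied to p^t and q^(1 - t). *)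
Lemma weighted_amgm (R : realType) (p q t : R) : 0 < p -> 0 < q -> 0 < t < 1 ->
  p `^ t * q `^ (1 - t) <= t * p + (1 - t) * q.
Proof.
move=> p0 q0 /andP[t0 t1].
have := @conjugate_powR R (p `^ t) (q `^ (1 - t)) t^-1 (1 - t)^-1.
rewrite !powR_ge0 !invr_gt0 !invrK t0 subr_gt0 t1 addrC subrK.
move=> /(_ isT isT isT isT erefl).
rewrite -!powRrM !divff ?gt_eqF ?subr_gt0// !powRr1 ?(ltW p0) ?(ltW q0)//.
by rewrite (mulrC p) (mulrC q).
Qed.

(** * Brunn-Minkowski for intervals and Prekopa-Leindler *)

Section prekopa_leindler.
Context {R : realType}.
Local Notation leb := (@lebesgue_measure R).
Local Open Scope ereal_scope.

Lemma lebesgue_measure_interval_le (A : set R) (l : R) : is_interval A ->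
  A !=set0 -> (forall x y, A x -> A y -> x <= y -> y - x <= l)%R ->
  leb A <= l%:E.
Proof.
move=> iA A0 Al; have [a0 Aa0] := A0.
have hi : has_inf A.
  split=> //; exists (a0 - l)%R => x Ax.
  have [xa|/ltW xa] := leP x a0; first by have := Al _ _ Ax Aa0 xa; lra.
  by have := Al _ _ Aa0 Aa0 (lexx _); lra.
have hs : has_sup A.
  split=> //; exists (a0 + l)%R => x Ax.
  have [xa|/ltW xa] := leP a0 x; first by have := Al _ _ Aa0 Ax xa; lra.
  by have := Al _ _ Aa0 Aa0 (lexx _); lra.
have l0 : (0 <= l)%R by have := Al _ _ Aa0 Aa0 (lexx _); lra.
have AI : A `<=` `[inf A, sup A].
  move=> x Ax /=; rewrite in_itv/=; apply/andP; split.
    by apply: ge_inf => //; exact: hi.2.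
  by apply: ub_le_sup => //; exact: hs.2.
have sil : (sup A - inf A <= l)%R.
  rewrite lerBlDr; apply: ge_sup => // x Ax.
  rewrite -lerBlDl; apply: lb_le_inf => // y Ay.
  have [xy|/ltW xy] := leP x y; last by have := Al _ _ Ay Ax xy; lra.
  lra.
apply: (@le_trans _ _ (leb `[inf A, sup A])).
  by apply: le_measure; rewrite ?inE//; exact: is_interval_measurable.
rewrite lebesgue_measure_itv/= lte_fin; case: ifP => _; last by rewrite lee_fin.
by rewrite -EFinB lee_fin.
Qed.

Lemma interval_lebesgue_measure_ge (C : set R) (a b : R) : is_interval C ->
  C a -> C b -> (b - a)%:E <= leb C.
Proof.
move=> iC Ca Cb.
have [ab|ba] := ltP a b; last first.
  by apply: (@le_trans _ _ 0); rewrite ?lee_fin ?subr_le0//.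
apply: (@le_trans _ _ (leb `[a, b])).
  by rewrite lebesgue_measure_itv/= lte_fin ab EFinB.
apply: le_measure; rewrite ?inE//; first exact: is_interval_measurable.
by move=> x /=; rewrite in_itv/=; exact: iC.
Qed.

(** For x, x' in [A] and y, y' in [B], the interval [C] contains both convex combinations, so its
    length is at least t (x' - x) + (1 - t) (y' - y). Varying x, x' bounds the length of [A];
    varying y, y' then bounds that of [B]. *)
Lemma brunn_minkowski_interval (A B C : set R) (t : R) : (0 < t < 1)%R ->
  is_interval A -> is_interval B -> is_interval C -> A !=set0 -> B !=set0 ->
  (forall x y, A x -> B y -> C (t * x + (1 - t) * y)%R) ->
  t%:E * leb A + (1 - t)%:E * leb B <= leb C.
Proof.
move=> /andP[t0 t1] iA iB iC A0 B0 ABC.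
have s0 : (0 < 1 - t)%R by lra.
have [->|] := eqVneq (leb C) +oo; first by rewrite leey.
rewrite -ltey => Cfin.
have cE : leb C \is a fin_num by rewrite ge0_fin_numE.
rewrite -(fineK cE); set c := fine (leb C).
have ABc x x' y y' : (A x -> A x' -> B y -> B y' ->
    t * (x' - x) + (1 - t) * (y' - y) <= c)%R.
  move=> Ax Ax' By By'; rewrite -lee_fin fineK//.
  apply: le_trans (interval_lebesgue_measure_ge iC (ABC _ _ Ax By) (ABC _ _ Ax' By')).
  by rewrite lee_fin; lra.
have Ab y y' : B y -> B y' -> leb A <= ((c - (1 - t) * (y' - y)) / t)%:E.
  move=> By By'; apply: lebesgue_measure_interval_le => // x x' Ax Ax' _.
  by rewrite ler_pdivlMr//; have := ABc _ _ _ _ Ax Ax' By By'; lra.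
have [y By] := B0.
have aE : leb A \is a fin_num.
  by rewrite ge0_fin_numE// (le_lt_trans (Ab _ _ By By))// ltry.
have Bb : leb B <= ((c - t * fine (leb A)) / (1 - t))%:E.
  apply: lebesgue_measure_interval_le => // {}y y' {}By By' _.
  have := Ab _ _ By By'; rewrite -(fineK aE) lee_fin ler_pdivlMr// fineK//.
  by rewrite ler_pdivlMr//; lra.
have bE : leb B \is a fin_num by rewrite ge0_fin_numE// (le_lt_trans Bb)// ltry.
move: Bb; rewrite -(fineK aE) -(fineK bE) -!EFinM -EFinD !lee_fin ler_pdivlMr//=.
lra.
Qed.

Lemma superlevel_integral (u : R -> R) (s : R) : log_concave1 u ->
  \int[leb]_x (if (s < u x)%R then 1%R else 0%R)%:E = leb [set x | (s < u x)%R].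
Proof.
move=> uP.
transitivity (\int[leb]_x (\1_[set x | (s < u x)%R] x)%:E).
  apply: eq_integral => x _; rewrite indicE; case: ifPn => sx.
    by rewrite mem_set.
  by rewrite memNset//=; exact/negP.
rewrite integral_indic ?setIT//.
by apply: is_interval_measurable; exact: log_concave1_gt_itv.
Qed.

Lemma log_concave1_superlevel_integral (u : R -> R) : log_concave1 u ->
  \int[leb]_x (u x)%:E =
  \int[leb]_(s in `[0%R, +oo[) leb [set x | (s < u x)%R].
Proof.
move=> uP; have mu := log_concave1_measurable uP.
transitivity (\int[leb]_x (cst 1 x * u x)%:E).
  by apply: eq_integral => x _; rewrite mul1r.
rewrite weighted_layer_cake//; last exact: uP.1.
by apply: eq_integral => s _; exact: superlevel_integral.
Qed.

Lemma measurable_log_concave1_superlevel (u : R -> R) : log_concave1 u ->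
  measurable_fun setT (fun s : measurableTypeR R => leb [set x | (s < u x)%R]).
Proof.
move=> uP; have mu := log_concave1_measurable uP.
have := @measurable_layer _ _ _ leb (cst 1%R) u.
move=> /(_ (measurable_cst _) mu (fun=> ler01)).
by apply: eq_measurable_fun => s _; exact: superlevel_integral.
Qed.

(** The superlevel sets of [u] and [v] at level s combine into that of [h], so Brunn-Minkowski
    applies level by level. Both suprema being 1, the two sets are nonempty for s < 1 and empty from
    level 1 on. *)
Lemma prekopa_leindler_normalized (u v h : R -> R) (t : R) : (0 < t < 1)%R ->
  log_concave1 u -> log_concave1 v -> log_concave1 h ->
  (forall x, u x <= 1)%R -> (forall x, v x <= 1)%R ->
  (forall s, s < 1 -> exists x, s < u x)%R ->
  (forall s, s < 1 -> exists x, s < v x)%R ->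
  (forall x y, u x `^ t * v y `^ (1 - t) <= h (t * x + (1 - t) * y))%R ->
  t%:E * \int[leb]_x (u x)%:E + (1 - t)%:E * \int[leb]_x (v x)%:E <=
  \int[leb]_x (h x)%:E.
Proof.
move=> t01 uP vP hP u1 v1 us vs uvh.
have /andP[t0 t1] := t01.
have s0 : (0 < 1 - t)%R by lra.
rewrite !log_concave1_superlevel_integral//.
have mS (f : R -> R) : log_concave1 f ->
    measurable_fun (`[0%R, +oo[ : set (measurableTypeR R))
      (fun s : measurableTypeR R => leb [set x | (s < f x)%R]).
  by move=> fP; apply: measurable_funTS; exact: measurable_log_concave1_superlevel.
rewrite -!ge0_integralZl_EFin ?(ltW t0) ?(ltW s0)//; [|exact: mS..].
rewrite -ge0_integralD//; first last.
- by apply: emeasurable_funM => //; exact: mS.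
- by move=> s _; rewrite mule_ge0// lee_fin ltW.
- by apply: emeasurable_funM => //; exact: mS.
- by move=> s _; rewrite mule_ge0// lee_fin ltW.
apply: ge0_le_integral => //.
- by move=> s _; apply: adde_ge0; rewrite mule_ge0// lee_fin ltW.
- by apply: emeasurable_funD; apply: emeasurable_funM => //; exact: mS.
- exact: mS.
move=> s; rewrite /= in_itv/= andbT => s_ge0.
have [s1|s1] := ltP s 1%R; last first.
  have E (f : R -> R) : (forall x, f x <= 1)%R -> [set x | (s < f x)%R] = set0.
    move=> f1; apply/seteqP; split=> // x /= /lt_le_trans /(_ (f1 x)).
    by rewrite ltNge s1.
  have l0 : leb set0 = 0 := measure0 _.
  by rewrite (E u)// (E v)// l0 !mule0 adde0.
apply: brunn_minkowski_interval => //; try exact: log_concave1_gt_itv.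
- by have [x sx] := us s s1; exists x.
- by have [x sx] := vs s s1; exists x.
move=> x y /= sx sy; apply: lt_le_trans (uvh x y).
have {1}-> : s = (s `^ t * s `^ (1 - t))%R.
  by rewrite -powRD ?(addrC t) ?subrK ?powRr1//; apply/implyP => /eqP; lra.
rewrite ltr_pM ?powR_ge0// gt0_ltr_powR// nnegrE//; exact: le_trans s_ge0 (ltW _).
Qed.

(** Dividing by the suprema reduces to the normalized case, whose arithmetic mean dominates the
    geometric one. *)
Lemma prekopa_leindler (u v h : R -> R) (t U V H : R) : (0 < t < 1)%R ->
  log_concave1 u -> log_concave1 v -> log_concave1 h ->
  (exists M, forall x, u x <= M)%R -> (exists M, forall x, v x <= M)%R ->
  (forall x y, u x `^ t * v y `^ (1 - t) <= h (t * x + (1 - t) * y))%R ->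
  \int[leb]_x (u x)%:E = U%:E -> \int[leb]_x (v x)%:E = V%:E ->
  \int[leb]_x (h x)%:E = H%:E ->
  (U `^ t * V `^ (1 - t) <= H)%R.
Proof.
move=> t01 uP vP hP [M uM] [N vN] uvh uU vV hH.
have /andP[t0 t1] := t01.
have H0 : (0 <= H)%R.
  by rewrite -lee_fin -hH; apply: integral_ge0 => x _; rewrite lee_fin hP.1.
(* A nonzero integral makes the supremum positive, which permits the division; a zero integral makes
   the left side of the goal zero. *)
have supP (f : R -> R) (F K : R) : log_concave1 f -> (forall x, f x <= K)%R ->
    \int[leb]_x (f x)%:E = F%:E -> F != 0%R ->
    [/\ (0 < F)%R, (0 < sup (range f))%R, forall x, (f x <= sup (range f))%R &
        forall s, (s < 1 -> exists x, s < (sup (range f))^-1 * f x)%R].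
  move=> fP fK fF F0.
  have hs : has_sup (range f).
    split; first by exists (f 0%R); exists 0%R.
    by exists K => _ [x _ <-].
  have fS x : (f x <= sup (range f))%R.
    by apply: ub_le_sup; [exact: hs.2|exists x].
  have F0' : (0 < F)%R.
    rewrite lt_def F0 -lee_fin -fF.
    by apply: integral_ge0 => x _; rewrite lee_fin fP.1.
  have S0 : (0 < sup (range f))%R.
    rewrite ltNge; apply/negP => S0; move: F0; apply/negP; rewrite negbK.
    have f0 x : f x = 0%R.
      by apply/eqP; rewrite eq_le (le_trans (fS x) S0) fP.1.
    move: fF; rewrite integral0_eq => [[<-//]|x _]; by rewrite f0.
  split=> // s s1.
  have [|_ [x _ <-] fx] := @sup_adherent _ (range f) ((1 - s) * sup (range f)) _ hs.
    by rewrite mulr_gt0// subr_gt0.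
  by exists x; rewrite mulrC ltr_pdivlMr//; lra.
have [->|U0] := eqVneq U 0%R; first by rewrite powR0 ?mul0r// gt_eqF.
have [->|V0] := eqVneq V 0%R; first by rewrite powR0 ?mulr0// gt_eqF ?subr_gt0.
have [U0' A0 uA As] := supP u U M uP uM uU U0.
have [V0' B0 vB Bs] := supP v V N vP vN vV V0.
set A := sup _ in A0 uA As; set B := sup _ in B0 vB Bs.
(* Dividing [h] by this constant preserves the inequality relating it to [u] and [v] once these are
   divided by [A] and [B]. *)
pose C := (A `^ t * B `^ (1 - t))%R.
have C0 : (0 < C)%R by rewrite mulr_gt0// powR_gt0.
have := @prekopa_leindler_normalized (fun x => A^-1 * u x)%R
  (fun x => B^-1 * v x)%R (fun x => C^-1 * h x)%R t t01.
have iA : (0 <= A^-1)%R by rewrite invr_ge0 ltW.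
have iB : (0 <= B^-1)%R by rewrite invr_ge0 ltW.
have iC : (0 <= C^-1)%R by rewrite invr_ge0 ltW.
have Z (f : R -> R) (a F : R) : log_concave1 f -> (0 <= a)%R ->
    \int[leb]_x (f x)%:E = F%:E -> \int[leb]_x (a * f x)%:E = (a * F)%:E.
  move=> fP a0 fF; under eq_integral do rewrite EFinM.
  rewrite ge0_integralZl_EFin ?fF//.
    by move=> x _; rewrite lee_fin fP.1.
  by apply/measurable_EFinP; exact: log_concave1_measurable.
rewrite (Z u _ U)// (Z v _ V)// (Z h _ H)//.
move=> /(_ (log_concave1Z iA uP) (log_concave1Z iB vP) (log_concave1Z iC hP)).
have -> : (t%:E * (A^-1 * U)%:E + (1 - t)%:E * (B^-1 * V)%:E =
   (t * (A^-1 * U) + (1 - t) * (B^-1 * V))%:E)%E by [].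
rewrite lee_fin => PL.
have {PL} : (t * (A^-1 * U) + (1 - t) * (B^-1 * V) <= C^-1 * H)%R.
  apply: PL => //.
  - by move=> x; rewrite mulrC ler_pdivrMr// mul1r.
  - by move=> x; rewrite mulrC ler_pdivrMr// mul1r.
  move=> x y; rewrite !powRM ?uP.1 ?vP.1// mulrACA.
  rewrite (_ : A^-1 `^ t * B^-1 `^ (1 - t) = C^-1)%R.
    by rewrite ler_pM2l// invr_gt0.
  have invP (a r : R) : (0 < a -> a^-1 `^ r = (a `^ r)^-1)%R.
    by move=> a0; rewrite -(powR_inv1 (ltW a0)) -powRrM mulN1r powRN.
  by rewrite (invP A)// (invP B)// -invfM.
rewrite ler_pdivlMl// => PL; apply: le_trans PL.
have amgm := @weighted_amgm _ (A^-1 * U)%R (B^-1 * V)%R t.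
have -> : (U `^ t * V `^ (1 - t) =
    C * ((A^-1 * U) `^ t * (B^-1 * V) `^ (1 - t)))%R.
  rewrite /C mulrACA -!powRM ?mulr_ge0// ?(ltW A0) ?(ltW B0) ?(ltW U0') ?(ltW V0')//.
  by rewrite !mulVKf// gt_eqF.
by rewrite ler_pM2l// amgm ?mulr_gt0 ?invr_gt0.
Qed.

End prekopa_leindler.

(** * Lebesgue measure on tuples *)

Section tuples.
Context {R : realType}.
Local Notation leb := (@lebesgue_measure R).
Local Notation gam := (@normal_pdf R 0 1).

Lemma convex_comb_tcons n t a b (x y : Rn R n) :
  convex_comb t (tcons (a, x)) (tcons (b, y)) =
  tcons (t * a + (1 - t) * b, convex_comb t x y).
Proof.
apply: eq_from_tnth => i; rewrite tnth_mktuple.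
case: (unliftP ord0 i) => [j|] ->; last by rewrite !tnth0.
by rewrite !tnthS tnth_mktuple.
Qed.

Lemma convex_combxx n t (x : Rn R n) : convex_comb t x x = x.
Proof.
by apply: eq_from_tnth => i; rewrite tnth_mktuple -mulrDl addrC subrK mul1r.
Qed.

Lemma gauss_density_tcons n a (x : Rn R n) :
  gauss_density (tcons (a, x)) = gam a * gauss_density x.
Proof.
rewrite /gauss_density normal_pdf1E subr0 mulrACA -expRD; congr (_ * expR _).
  rewrite /normal_peak expr1n mul1r -(mulr_natl pi) -powR12_sqrt ?mulr_ge0 ?pi_ge0//.
  rewrite -powRN -powRD; last first.
    by apply/implyP => _; rewrite gt_eqF// mulr_gt0// pi_gt0.
  by congr (_ `^ _); rewrite -natr1; field.
rewrite /sqnorm big_ord_recl tnth0 mulrDl opprD mulNr; congr (_ + - (_ / _)).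
by apply: eq_bigr => i _; rewrite tnthS.
Qed.

Lemma gauss_density_gt0 n (x : Rn R n) : 0 < gauss_density x.
Proof. by rewrite mulr_gt0 ?expR_gt0// powR_gt0// mulr_gt0 ?pi_gt0. Qed.

(** Follows from 2 pi >= 1. It makes the truncations at 0 in the functions [theta] for q >= 1
    inactive along the Gaussian. *)
Lemma gauss_density_le1 n (x : Rn R n) : gauss_density x <= 1.
Proof.
rewrite -[leRHS]mulr1 ler_pM ?powR_ge0 ?expR_ge0//.
  rewrite powRN invf_le1 ?powR_gt0 ?mulr_gt0 ?pi_gt0//.
  rewrite -[leLHS](powRr0 (2 * pi)) ler_powR//.
  by rewrite (@le_trans _ _ (2 * 2))// ?ler_pM2l ?pi_ge2//; lra.
by rewrite expR_le1 oppr_le0 divr_ge0// sumr_ge0// => i _; exact: sqr_ge0.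
Qed.

Lemma measurable_gauss_density n : measurable_fun setT (@gauss_density R n).
Proof.
apply: measurable_funM => //; apply: measurableT_comp => //.
apply: measurableT_comp => //; apply: measurable_funM => //.
apply: measurable_sum => i; apply: measurable_funX; exact: measurable_tnth.
Qed.

Local Open Scope ereal_scope.

Lemma integral_lebesgue_tuple0 (h : Rn R 0 -> \bar R) :
  measurable_fun setT h ->
  \int[lebesgue_tuple R 0]_z h z = h ([tuple] : Rn R 0).
Proof.
move=> mh; rewrite (integral_dirac ([tuple] : Rn R 0) measurableT)//.
by rewrite diracT mul1e.
Qed.

Lemma integral_lebesgue_tuple_succ n (h : Rn R n.+1 -> \bar R) :
  measurable_fun setT h -> (forall x, 0 <= h x) ->
  \int[lebesgue_tuple R n.+1]_z h z =
  \int[lebesgue_tuple R n]_x \int[leb]_a h (tcons (a, x)).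
Proof.
move=> mh h0.
rewrite (@ge0_integral_pushforward _ _ _ _ _ _ (@measurable_tcons R n)
  (leb \x lebesgue_tuple R n) setT h)//.
rewrite preimage_setT.
rewrite (fubini_tonelli2 (h \o @tcons R n))//.
  by apply: measurableT_comp => //; exact: measurable_tcons.
by move=> p; exact: h0.
Qed.

Lemma integral_gauss_density n :
  \int[lebesgue_tuple R n]_x (gauss_density x)%:E = 1.
Proof.
have mg k : measurable_fun setT (fun x : Rn R k => (gauss_density x)%:E).
  by apply/measurable_EFinP; exact: measurable_gauss_density.
have g0 k (x : Rn R k) : 0 <= (gauss_density x)%:E.
  by rewrite lee_fin ltW// gauss_density_gt0.
elim: n => [|n IH].
  rewrite integral_lebesgue_tuple0// /gauss_density /sqnorm big_ord0.
  by rewrite !mul0r !oppr0 powRr0 expR0 mulr1.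
rewrite integral_lebesgue_tuple_succ// -IH; apply: eq_integral => x _.
under eq_integral do rewrite gauss_density_tcons mulrC EFinM.
rewrite ge0_integralZl_EFin//; last first.
- by apply: ltW; exact: gauss_density_gt0.
- by apply/measurable_EFinP; exact: measurable_normal_pdf.
- by move=> a _; rewrite lee_fin normal_pdf_ge0.
by rewrite integral_normal_pdf mule1.
Qed.

(** The indicator of a null set has integral 0, so by Tonelli its slices have measure 0 for almost
    every [x]. *)
Lemma ae_lebesgue_tuple_succ n (P : Rn R n.+1 -> Prop) :
  {ae lebesgue_tuple R n.+1, forall z, P z} ->
  {ae lebesgue_tuple R n, forall x, {ae leb, forall a, P (tcons (a, x))}}.
Proof.
move=> [N [mN N0 PN]].
have m1 : measurable_fun setT (fun z : Rn R n.+1 => (\1_N z)%:E : \bar R).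
  by apply/measurable_EFinP; exact: measurable_indic.
have mslice x : measurable [set a : measurableTypeR R | N (tcons (a, x))].
  rewrite -[X in measurable X]setTI.
  apply: (_ : measurable_fun setT (fun a : measurableTypeR R => tcons (a, x))) => //.
  apply: measurableT_comp; [exact: measurable_tcons|exact: measurable_pair2].
have : \int[lebesgue_tuple R n.+1]_z (\1_N z)%:E = 0.
  by rewrite integral_indic// setIT.
rewrite integral_lebesgue_tuple_succ//.
move=> I0.
have inner x : \int[leb]_a (\1_N (tcons (a, x)))%:E =
    leb [set a | N (tcons (a, x))].
  transitivity (\int[leb]_a (\1_[set a | N (tcons (a, x))] a)%:E).
    apply: eq_integral => a _; rewrite !indicE.
    by congr (_%:R%:E); apply/idP/idP; rewrite !inE.
  by rewrite integral_indic ?setIT//; exact: mslice.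
have [M [mM M0 HM]] : {ae lebesgue_tuple R n, forall x,
    \int[leb]_a (\1_N (tcons (a, x)))%:E = 0}.
  have : ae_eq (lebesgue_tuple R n) setT
      (fun x => \int[leb]_a (\1_N (tcons (a, x)))%:E) (cst 0).
    apply/ae_eq_integral_abs => //.
      apply: (measurable_fun_fubini_tonelli_G (fun p => (\1_N (tcons p))%:E)).
        exact: (measurableT_comp m1 (@measurable_tcons R n)).
      by move=> p; rewrite lee_fin.
    rewrite -I0; apply: eq_integral => x _.
    by rewrite gee0_abs// integral_ge0// => a _; rewrite lee_fin.
  by apply: filterS => x /(_ I).
exists M; split=> // x /= nP; apply: HM => /= x0; apply: nP.
exists [set a | N (tcons (a, x))]; split=> //.
  by rewrite -inner.
by move=> a /= nPa; exact: PN.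
Qed.

End tuples.

(** * Gaussian marginals and the comparison in all dimensions *)

Section gaussian_marginal.
Context {R : realType}.
Local Notation leb := (@lebesgue_measure R).
Local Notation gam := (@normal_pdf R 0 1).

Definition log_concave n (W : Rn R n -> R) : Prop :=
  (forall x, 0 <= W x) /\
  forall t x y, 0 < t < 1 ->
    W x `^ t * W y `^ (1 - t) <= W (convex_comb t x y).

Lemma log_concave_slice n (W : Rn R n.+1 -> R) (x : Rn R n) :
  log_concave W -> log_concave1 (fun a => W (tcons (a, x))).
Proof.
move=> [W0 WP]; split=> // t a b t01; apply: le_trans (WP _ _ _ t01) _.
by rewrite convex_comb_tcons convex_combxx.
Qed.

(* The density W * gauss_density has the marginal gauss_marginal W * gauss_density. *)
Definition gauss_marginal n (W : Rn R n.+1 -> R) (x : Rn R n) : R :=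
  fine (\int[leb]_a (W (tcons (a, x)) * gam a)%:E).

Lemma gauss_marginalE n (W : Rn R n.+1 -> R) (x : Rn R n) : log_concave W ->
  (\int[leb]_a (W (tcons (a, x)) * gam a)%:E = (gauss_marginal W x)%:E)%E.
Proof.
move=> /(log_concave_slice x) /log_concave1_normal_integrable WI.
by rewrite /gauss_marginal fineK//; exact: integrable_fin_num.
Qed.

(** One-dimensional Prekopa-Leindler, applied to the slices weighted by [gam], which is itself
    log-concave. Following the factor [W] instead of the density carries strong log-concavity over
    to the marginal. *)
Lemma log_concave_gauss_marginal n (W : Rn R n.+1 -> R) :
  log_concave W -> log_concave (gauss_marginal W).
Proof.
move=> WP; split=> [x|t x y t01].
  rewrite -lee_fin -gauss_marginalE//; apply: integral_ge0 => a _.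
  by rewrite lee_fin mulr_ge0 ?normal_pdf_ge0// WP.1.
have lc z : log_concave1 (fun a => W (tcons (a, z)) * gam a).
  by apply: log_concave1M; [exact: log_concave_slice|exact: log_concave1_normal_pdf].
have bd z : exists M, forall a, W (tcons (a, z)) * gam a <= M.
  by apply: log_concave1_normal_bounded; exact: log_concave_slice.
apply: (prekopa_leindler t01 (lc x) (lc y) (lc (convex_comb t x y)) (bd x) (bd y));
  rewrite ?gauss_marginalE// => a b.
rewrite !powRM ?WP.1 ?normal_pdf_ge0// mulrACA -convex_comb_tcons.
rewrite ler_pM ?mulr_ge0 ?powR_ge0//; first exact: WP.2.
exact: (log_concave1_normal_pdf 0).2.
Qed.

Local Open Scope ereal_scope.

(** Homogeneity reduces to the case [F = 1]; when [F = 0] the left side is zero. *)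
Lemma integral_below_slice_le (w : R -> R) (F c : R) : log_concave1 w ->
  \int[leb]_z (w z * gam z)%:E = F%:E ->
  \int[leb]_z (below c (w z * gam z))%:E <= \int[leb]_z (below c (F * gam z))%:E.
Proof.
move=> wP wF; have mk := log_concave1_normal_measurable wP.
have F0 : (0 <= F)%R.
  rewrite -lee_fin -wF; apply: integral_ge0 => z _.
  by rewrite lee_fin mulr_ge0 ?normal_pdf_ge0// wP.1.
have k0 z : (0 <= w z * gam z)%R by rewrite mulr_ge0 ?normal_pdf_ge0// wP.1.
have [FE|Fn0] := eqVneq F 0%R.
  apply: (@le_trans _ _ 0); last first.
    apply: integral_ge0 => z _.
    by rewrite lee_fin below_ge0// mulr_ge0 ?normal_pdf_ge0.
  have <- : \int[leb]_z (w z * gam z)%:E = 0 by rewrite wF FE.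
  apply: ge0_le_integral => //.
  - by move=> z _; rewrite lee_fin below_ge0.
  - by apply/measurable_EFinP; apply: measurableT_comp => //; exact: measurable_below.
  - exact/measurable_EFinP.
  - by move=> z _; rewrite lee_fin below_le.
have {}F0 : (0 < F)%R by rewrite lt_def Fn0.
have iF0 : (0 <= F^-1)%R by rewrite invr_ge0 ltW.
have kE z : (w z * gam z = F * ((F^-1 * w z) * gam z))%R.
  by rewrite -mulrA mulVKf.
have := @integral_below_normal_le _ _ (log_concave1Z iF0 wP) _ (c / F).
have -> : \int[leb]_z (F^-1 * w z * gam z)%:E = 1.
  under eq_integral do rewrite -mulrA EFinM.
  rewrite ge0_integralZl_EFin// ?wF -?EFinM ?mulVf//.
    by move=> z _; rewrite lee_fin.
  exact/measurable_EFinP.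
move=> /(_ erefl) le.
under eq_integral do rewrite kE belowM// EFinM.
under [leRHS]eq_integral do rewrite belowM// EFinM.
rewrite !ge0_integralZl_EFin ?(ltW F0)//.
- by apply: lee_wpmul2l => //; rewrite lee_fin ltW.
- by move=> z _; rewrite lee_fin below_ge0// normal_pdf_ge0.
- apply/measurable_EFinP; apply: measurableT_comp; first exact: measurable_below.
  exact: measurable_normal_pdf.
- move=> z _; rewrite lee_fin below_ge0// mulr_ge0 ?normal_pdf_ge0//.
  by rewrite mulr_ge0// wP.1.
- apply/measurable_EFinP; apply: measurableT_comp; first exact: measurable_below.
  exact: (log_concave1_normal_measurable (log_concave1Z iF0 wP)).
Qed.

(** By induction: for almost every [x] the slice of [f] is compared with the Gaussian slice of the
    same mass [h x]; then, for each fixed [a], the induction hypothesis compares [h] with the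
    Gaussian at the threshold c / gam a. *)
Lemma integral_below_gauss_le n (W f : Rn R n -> R) : log_concave W ->
  probability_density f ->
  {ae lebesgue_tuple R n, forall x, f x = W x * gauss_density x}%R ->
  forall c, \int[lebesgue_tuple R n]_x (below c (f x))%:E <=
            \int[lebesgue_tuple R n]_x (below c (gauss_density x))%:E.
Proof.
elim: n => [|n IH] in W f *.
  (* On the one-point space R^0 both densities equal 1. *)
  move=> _ [mf f0 f1] _ c.
  have mb (h : Rn R 0 -> R) : measurable_fun setT h ->
      measurable_fun setT (fun x => (below c (h x))%:E).
    move=> mh; apply/measurable_EFinP; apply: measurableT_comp mh.
    exact: measurable_below.
  have mg := @measurable_gauss_density R 0.
  have g1 := @integral_gauss_density R 0.
  move: f1 g1; rewrite !integral_lebesgue_tuple0//;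
    try exact/measurable_EFinP; try exact: mb.
  by move=> [->] [->].
move=> WP [mf f0 f1] fW c.
set mu := lebesgue_tuple R n.
pose Fx (x : Rn R n) := \int[leb]_a (f (tcons (a, x)))%:E.
(* The slice integral may be infinite on a null set of [x], as [f] is controlled only almost
   everywhere; [fine] gives 0 there. *)
pose h x := fine (Fx x).
have mtc : measurable_fun setT (fun p => f (tcons p)).
  by apply: measurableT_comp => //; exact: measurable_tcons.
have msl (x : Rn R n) :
    measurable_fun setT (fun a : measurableTypeR R => f (tcons (a, x))).
  exact: (measurableT_comp mtc (measurable_pair2 _)).
have mF : measurable_fun setT Fx.
  apply: (measurable_fun_fubini_tonelli_G (fun p => (f (tcons p))%:E)).
    exact/measurable_EFinP.
  by move=> p; rewrite lee_fin.
have mh : measurable_fun setT h by apply: measurableT_comp.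
have F0 x : 0 <= Fx x by apply: integral_ge0 => a _; rewrite lee_fin.
have h0 x : (0 <= h x)%R by rewrite fine_ge0.
have good := ae_lebesgue_tuple_succ fW.
have mW x : measurable_fun setT
    (fun a => gauss_density x * W (tcons (a, x)) * gam a)%R.
  apply: log_concave1_normal_measurable.
  by apply: log_concave1Z; [rewrite ltW ?gauss_density_gt0|exact: log_concave_slice].
have wgE x : \int[leb]_a (gauss_density x * W (tcons (a, x)) * gam a)%:E =
    (gauss_density x * gauss_marginal W x)%:E.
  under eq_integral do rewrite -mulrA EFinM.
  rewrite ge0_integralZl_EFin ?gauss_marginalE//.
  - by move=> a _; rewrite lee_fin mulr_ge0 ?normal_pdf_ge0// WP.1.
  - apply/measurable_EFinP.
    exact: (log_concave1_normal_measurable (log_concave_slice x WP)).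
  - by rewrite ltW// gauss_density_gt0.
have goodE x : {ae leb, forall a,
      f (tcons (a, x)) = W (tcons (a, x)) * gauss_density (tcons (a, x))}%R ->
    {ae leb, forall a, f (tcons (a, x)) =
      gauss_density x * W (tcons (a, x)) * gam a}%R.
  by apply: filterS => a ->; rewrite gauss_density_tcons; ring.
have w0 x a : (0 <= gauss_density x * W (tcons (a, x)) * gam a)%R.
  apply: mulr_ge0; last exact: normal_pdf_ge0.
  by apply: mulr_ge0; [rewrite ltW ?gauss_density_gt0|exact: WP.1].
have FxE : {ae mu, forall x, Fx x = (gauss_density x * gauss_marginal W x)%:E}.
  apply: filterS good => x /goodE gx; rewrite -wgE.
  apply: ge0_ae_eq_integral => //.
  - exact/measurable_EFinP.
  - exact/measurable_EFinP.
  - by move=> a _; rewrite lee_fin.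
  - by move=> a _; rewrite lee_fin.
  - by apply: filterS gx => a /= -> _.
have hP : probability_density h.
  split=> //; rewrite -f1 integral_lebesgue_tuple_succ; last first.
  - by move=> x; rewrite lee_fin.
  - exact/measurable_EFinP.
  apply: ge0_ae_eq_integral => //.
  - exact/measurable_EFinP.
  - by move=> x _; rewrite lee_fin.
  - by move=> x _; exact: F0.
  - by apply: filterS FxE => x /= xE _; rewrite /h -/(Fx x) xE.
have hE : {ae mu, forall x, h x = gauss_marginal W x * gauss_density x}%R.
  by apply: filterS FxE => x; rewrite /h => -> /=; rewrite mulrC.
have {}IH := IH _ _ (log_concave_gauss_marginal WP) hP hE.
have mb (k : Rn R n -> R) : measurable_fun setT k ->
    measurable_fun setT (fun p : measurableTypeR R * Rn R n =>
      (below c (k p.2 * gam p.1))%:E).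
  move=> mk; apply/measurable_EFinP; apply: (measurableT_comp (measurable_below c)).
  apply: measurable_funM; first exact: measurableT_comp.
  by apply: measurableT_comp => //; exact: measurable_normal_pdf.
have b0 (k : Rn R n -> R) : (forall x, 0 <= k x)%R ->
    forall p : measurableTypeR R * Rn R n, 0 <= (below c (k p.2 * gam p.1))%:E.
  by move=> k0 p; rewrite lee_fin below_ge0// mulr_ge0 ?normal_pdf_ge0.
(* Integrating over [x] first makes [gam a] a constant factor, and [belowM] moves it into the
   threshold. *)
have swap (k : Rn R n -> R) : measurable_fun setT k -> (forall x, 0 <= k x)%R ->
    \int[mu]_x \int[leb]_a (below c (k x * gam a))%:E =
    \int[leb]_a ((gam a)%:E * \int[mu]_x (below (c / gam a) (k x))%:E).
  move=> mk k0.
  have /= <- := fubini_tonelli (m1 := leb) (m2 := mu)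
    (fun p => (below c (k p.2 * gam p.1))%:E) (mb k mk) (b0 k k0).
  apply: eq_integral => a _ /=.
  under eq_integral do rewrite mulrC (belowM _ _ (normal_pdf1_gt0 0 a)) EFinM.
  rewrite ge0_integralZl_EFin ?normal_pdf_ge0//.
    by move=> x _; rewrite lee_fin below_ge0.
  by apply/measurable_EFinP; apply: measurableT_comp mk; exact: measurable_below.
have g0 (x : Rn R n) : (0 <= gauss_density x)%R by rewrite ltW// gauss_density_gt0.
have mg := @measurable_gauss_density R n.
have mbf : measurable_fun setT (fun x => (below c (f x))%:E).
  by apply/measurable_EFinP; apply: measurableT_comp mf; exact: measurable_below.
have mbg : measurable_fun setT (fun x : Rn R n.+1 => (below c (gauss_density x))%:E).
  apply/measurable_EFinP; apply: measurableT_comp; first exact: measurable_below.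
  exact: measurable_gauss_density.
rewrite !integral_lebesgue_tuple_succ//; first last.
- by move=> x; rewrite lee_fin below_ge0.
- by move=> x; rewrite lee_fin below_ge0// ltW// gauss_density_gt0.
under [leRHS]eq_integral do under eq_integral do rewrite gauss_density_tcons mulrC.
(* The intermediate density h x * gam a keeps the marginal of [f] and replaces its conditional laws
   by the Gaussian. *)
apply: (@le_trans _ _ (\int[mu]_x \int[leb]_a (below c (h x * gam a))%:E)); last first.
  rewrite (swap h mh h0) (swap _ mg g0).
  have mi (k : Rn R n -> R) : measurable_fun setT k -> (forall x, 0 <= k x)%R ->
      measurable_fun setT (fun a : measurableTypeR R =>
        (gam a)%:E * \int[mu]_x (below (c / gam a) (k x))%:E).
    move=> mk k0.
    have := measurable_fun_fubini_tonelli_F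
      (m2 := mu) (fun p => (below c (k p.2 * gam p.1))%:E) (mb k mk) (b0 k k0).
    apply: eq_measurable_fun => a _; rewrite /fubini_F/=.
    under eq_integral do rewrite mulrC (belowM _ _ (normal_pdf1_gt0 0 a)) EFinM.
    rewrite ge0_integralZl_EFin ?normal_pdf_ge0//.
      by move=> x _; rewrite lee_fin below_ge0.
    by apply/measurable_EFinP; apply: measurableT_comp mk; exact: measurable_below.
  apply: ge0_le_integral => //.
  - move=> a _; rewrite mule_ge0 ?lee_fin ?normal_pdf_ge0//.
    by apply: integral_ge0 => x _; rewrite lee_fin below_ge0.
  - exact: mi.
  - exact: mi.
  - by move=> a _; apply: lee_wpmul2l; rewrite ?lee_fin ?normal_pdf_ge0.
have mG (k : Rn R n -> R) : measurable_fun setT k -> (forall x, 0 <= k x)%R ->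
    measurable_fun setT (fun x => \int[leb]_a (below c (k x * gam a))%:E).
  move=> mk k0; exact: (measurable_fun_fubini_tonelli_G
    (m1 := leb) (fun p => (below c (k p.2 * gam p.1))%:E) (mb k mk) (b0 k k0)).
apply: ae_ge0_le_integral => //.
- by move=> x _; apply: integral_ge0 => a _; rewrite lee_fin below_ge0.
- apply: (measurable_fun_fubini_tonelli_G (fun p => (below c (f (tcons p)))%:E)).
    exact: (measurableT_comp mbf (@measurable_tcons R n)).
  by move=> p; rewrite lee_fin below_ge0.
- move=> x _; apply: integral_ge0 => a _.
  by rewrite lee_fin below_ge0// mulr_ge0 ?normal_pdf_ge0.
- exact: mG.
apply: filterS2 good FxE => x /goodE gx xE _.
have wP : log_concave1 (fun a => gauss_density x * W (tcons (a, x)))%R.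
  by apply: log_concave1Z => //; exact: log_concave_slice.
have -> : h x = (gauss_density x * gauss_marginal W x)%R by rewrite /h xE.
apply: le_trans (integral_below_slice_le c wP (wgE x)).
(* The slice of [f] agrees with its log-concave representative almost everywhere, which suffices for
   the integrals. *)
rewrite le_eqVlt; apply/orP; left; apply/eqP; apply: ge0_ae_eq_integral => //.
- apply: (measurableT_comp mbf).
  exact: (measurableT_comp (@measurable_tcons R n) (measurable_pair2 _)).
- by apply/measurable_EFinP; apply: measurableT_comp (mW x); exact: measurable_below.
- by move=> a _; rewrite lee_fin below_ge0.
- by move=> a _; rewrite lee_fin below_ge0.
- by apply: filterS gx => a /= -> _.
Qed.

End gaussian_marginal.

(** * Entropies *)

Lemma ltr_powR2r (R : realType) (r u v : R) : 0 < r -> 0 <= u -> 0 <= v ->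
  (u `^ r < v `^ r) = (u < v).
Proof.
move=> r0 u0 v0; apply/idP/idP => [|uv]; last by rewrite gt0_ltr_powR.
by apply: contraTT; rewrite -!leNgt => vu; rewrite ge0_ler_powR ?(ltW r0).
Qed.

Section entropy_comparison.
Context {R : realType} {n : nat}.
Local Notation mu := (lebesgue_tuple R n).
Local Notation gauss := (@gauss_density R n).
Variable f : Rn R n -> R.
Local Open Scope ereal_scope.

Hypothesis fP : probability_density f.
Hypothesis below_le : forall c,
  \int[mu]_x (below c (f x))%:E <= \int[mu]_x (below c (gauss x))%:E.

Let mf : measurable_fun setT f. Proof. by case: fP. Qed.
Let f0 x : (0 <= f x)%R. Proof. by case: fP. Qed.
Let f1 : \int[mu]_x (f x)%:E = 1. Proof. by case: fP. Qed.
Let mg := @measurable_gauss_density R n.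
Let g0 x : (0 < gauss x)%R. Proof. exact: gauss_density_gt0. Qed.
Let g0' x : (0 <= gauss x)%R. Proof. exact: ltW. Qed.
Let g1 := @integral_gauss_density R n.

(** Layer cake with [f] as the weight: on u > 0 each superlevel set of [theta] is given by u < c or
    is everything, so the layer is the mass of [f < c] or the total mass 1. The point u = 0 is left
    out because the weight vanishes there. *)
Lemma integral_decreasing_le (theta : R -> R) :
  measurable_fun setT theta -> (forall u, 0 <= u -> 0 <= theta u)%R ->
  (forall s, (0 <= s)%R -> (exists c, forall u, 0 < u -> (s < theta u) = (u < c))%R \/
     (forall u, 0 < u -> s < theta u)%R) ->
  \int[mu]_x (f x * theta (f x))%:E <= \int[mu]_x (gauss x * theta (gauss x))%:E.
Proof.
move=> mt t0 tP.
have mtf : measurable_fun setT (theta \o f) by exact: measurableT_comp.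
have mtg : measurable_fun setT (theta \o gauss) by exact: measurableT_comp.
rewrite (weighted_layer_cake mu mf mtf f0 (fun x => t0 _ (f0 x))).
rewrite (weighted_layer_cake mu mg mtg g0' (fun x => t0 _ (g0' x))).
apply: ge0_le_integral => //.
- by move=> s _; apply: integral_ge0 => x _; case: ifP => _; rewrite lee_fin.
- by apply: measurable_funTS; exact: (measurable_layer mu mf mtf f0).
- by apply: measurable_funTS; exact: (measurable_layer mu mg mtg g0').
move=> s; rewrite /= in_itv/= andbT => /tP[[c sc]|sall].
  have E (h : Rn R n -> R) : (forall x, 0 <= h x)%R ->
      \int[mu]_x (if (s < theta (h x))%R then h x else 0%R)%:E =
      \int[mu]_x (below c (h x))%:E.
    move=> h0; apply: eq_integral => x _; rewrite /below.
    have := h0 x; rewrite le_eqVlt => /orP[/eqP<-|hx]; first by rewrite !if_same.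
    by rewrite sc.
  by rewrite !E.
have E (h : Rn R n -> R) : (forall x, 0 <= h x)%R ->
    \int[mu]_x (if (s < theta (h x))%R then h x else 0%R)%:E =
    \int[mu]_x (h x)%:E.
  move=> h0; apply: eq_integral => x _.
  have := h0 x; rewrite le_eqVlt => /orP[/eqP<-|hx]; first by rewrite !if_same.
  by rewrite sall.
by rewrite !E// f1 g1.
Qed.

(** Here [theta] is u^(q - 1). The product u * u^(q - 1) is not simplified to u^q so as to include q
    = 0, where the product is the indicator of u > 0 but u^0 is 1 also at 0. *)
Lemma integral_powRB1_le (q : R) : (q < 1)%R ->
  \int[mu]_x (f x * f x `^ (q - 1))%R%:E <=
  \int[mu]_x (gauss x * gauss x `^ (q - 1))%R%:E.
Proof.
move=> q1; apply: (integral_decreasing_le (theta := fun u => u `^ (q - 1))%R).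
- exact: measurable_powR.
- by move=> u _; exact: powR_ge0.
have r0 : (0 < 1 - q)%R by rewrite subr_gt0.
move=> s; rewrite le_eqVlt => /orP[/eqP<-|s0].
  by right => u u0; rewrite powR_gt0.
(* The threshold solves c^(q - 1) = s. *)
left; exists ((s^-1) `^ (1 - q)^-1)%R => u u0.
have si : (0 < s^-1)%R by rewrite invr_gt0.
have cE : (s = (((s^-1) `^ (1 - q)^-1) `^ (1 - q))^-1)%R.
  by rewrite -powRrM mulVf ?gt_eqF// powRr1 ?invrK// ltW.
rewrite {1}cE -(opprB 1%R q) powRN ltf_pV2 ?posrE ?powR_gt0//.
by rewrite ltr_powR2r ?powR_ge0 ?(ltW u0).
Qed.

Lemma measure_support_le :
  mu [set x | 0 < f x]%R <= mu [set x | 0 < gauss x]%R.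
Proof.
have E (h : Rn R n -> R) : measurable_fun setT h -> (forall x, 0 <= h x)%R ->
    \int[mu]_x (h x * h x `^ (0 - 1))%R%:E = mu [set x | 0 < h x]%R.
  move=> mh h0.
  have mS : measurable [set x | 0 < h x]%R.
    rewrite -[X in measurable X]setTI.
    rewrite (_ : [set x | 0 < h x]%R = h @^-1` `]0%R, +oo[); first exact: mh.
    by apply/seteqP; split => x /=; rewrite in_itv/= andbT.
  transitivity (\int[mu]_x (\1_[set x | 0 < h x]%R x)%:E); last first.
    by rewrite integral_indic ?setIT.
  apply: eq_integral => x _; rewrite sub0r indicE.
  have := h0 x; rewrite le_eqVlt => /orP[/eqP hx|hx].
    by rewrite -hx mul0r memNset//= -hx ltxx.
  by rewrite powRN powRr1// divff ?gt_eqF// mem_set.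
by rewrite -(E f mf f0) -(E gauss mg g0'); exact: integral_powRB1_le.
Qed.

Lemma integral_powR_le (q : R) : (0 < q < 1)%R ->
  \int[mu]_x (f x `^ q)%R%:E <= \int[mu]_x (gauss x `^ q)%R%:E.
Proof.
move=> /andP[q0 q1].
under eq_integral do rewrite -mulr_powRB1//.
under [leRHS]eq_integral do rewrite -mulr_powRB1//.
exact: integral_powRB1_le.
Qed.

(** With theta(u) = max(0, 1 - u^(q - 1)), the quantity u theta(u) + u^q is at least u, with
    equality for u <= 1. Its integral is at least 1 for [f] and exactly 1 for the Gaussian, which
    reverses the comparison. *)
Lemma integral_powR_ge (q : R) : (1 < q)%R ->
  \int[mu]_x (gauss x `^ q)%R%:E <= \int[mu]_x (f x `^ q)%R%:E.
Proof.
move=> q1; have q0 : (0 < q)%R by lra.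
have r0 : (0 < q - 1)%R by lra.
pose theta u : R := Num.max 0%R (1 - u `^ (q - 1))%R.
have mt : measurable_fun setT theta.
  by apply: measurable_maxr => //; apply: measurable_funB => //; exact: measurable_powR.
have t0 u : (0 <= theta u)%R by rewrite le_max lexx.
have le : \int[mu]_x (f x * theta (f x))%:E <= \int[mu]_x (gauss x * theta (gauss x))%:E.
  apply: integral_decreasing_le => // s s0; left.
  (* For s >= 1 the superlevel set of [theta] is empty, which the threshold 0 encodes. *)
  have [s1|s1] := ltP s 1%R; last first.
    exists 0%R => u u0; rewrite [RHS]ltNge (ltW u0)/= lt_max (le_gtF s0)/=.
    by apply/negbTE; rewrite -leNgt (le_trans _ s1)// gerBl powR_ge0.
  have r1 : (0 < 1 - s)%R by lra.
  exists ((1 - s) `^ (q - 1)^-1)%R => u u0.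
  rewrite lt_max (le_gtF s0)/=.
  have cE : (1 - s = ((1 - s) `^ (q - 1)^-1) `^ (q - 1))%R.
    by rewrite -powRrM mulVf ?gt_eqF// powRr1// ltW.
  have -> : (s < 1 - u `^ (q - 1))%R = (u `^ (q - 1) < 1 - s)%R by apply/idP/idP; lra.
  by rewrite {1}cE ltr_powR2r ?powR_ge0 ?(ltW u0).
have mH (h : Rn R n -> R) : measurable_fun setT h ->
    measurable_fun setT (fun x => (h x * theta (h x))%:E).
  move=> mh; apply/measurable_EFinP; apply: measurable_funM => //.
  exact: measurableT_comp.
have mP (h : Rn R n -> R) : measurable_fun setT h ->
    measurable_fun setT (fun x => (h x `^ q)%R%:E).
  move=> mh; apply/measurable_EFinP; apply: (measurableT_comp (measurable_powR q) mh).
have fle : 1 <= \int[mu]_x (f x * theta (f x))%:E + \int[mu]_x (f x `^ q)%R%:E.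
  rewrite -f1 -ge0_integralD//; try exact: mH; try exact: mP; first last.
  - by move=> x _; rewrite lee_fin powR_ge0.
  - by move=> x _; rewrite lee_fin mulr_ge0.
  apply: ge0_le_integral => //.
  - by move=> x _; rewrite lee_fin.
  - exact/measurable_EFinP.
  - by apply: emeasurable_funD; [exact: mH|exact: mP].
  move=> x _; rewrite -EFinD lee_fin -(mulr_powRB1 (f0 x) q0) -mulrDr.
  rewrite -[leLHS]mulr1 ler_wpM2l// -lerBlDr le_max lexx orbT//.
have gE : 1 = \int[mu]_x (gauss x * theta (gauss x))%:E + \int[mu]_x (gauss x `^ q)%R%:E.
  rewrite -g1 -ge0_integralD//; try exact: mH; try exact: mP; first last.
  - by move=> x _; rewrite lee_fin powR_ge0.
  - by move=> x _; rewrite lee_fin mulr_ge0.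
  apply: eq_integral => x _; rewrite -EFinD -(mulr_powRB1 (g0' x) q0) -mulrDr.
  rewrite /theta max_r ?subrK ?mulr1// subr_ge0.
  have /= := @ge0_ler_powR R (q - 1) (ltW r0) (gauss x) 1%R.
  by rewrite !nnegrE ler01 powR1 => -> //; exact: gauss_density_le1.
have Pge0 (h : Rn R n -> R) : 0 <= \int[mu]_x (h x `^ q)%R%:E.
  by apply: integral_ge0 => x _; rewrite lee_fin powR_ge0.
have Tge0 (h : Rn R n -> R) : (forall x, 0 <= h x)%R ->
    0 <= \int[mu]_x (h x * theta (h x))%:E.
  by move=> h0; apply: integral_ge0 => x _; rewrite lee_fin mulr_ge0.
move: (Tge0 _ f0) (Tge0 _ g0') (Pge0 f) (Pge0 gauss) le fle gE.
move: (\int[mu]_x (f x * theta (f x))%:E) (\int[mu]_x (gauss x * theta (gauss x))%:E).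
move: (\int[mu]_x (f x `^ q)%R%:E) (\int[mu]_x (gauss x `^ q)%R%:E).
move=> [a| |] [b| |] [c| |] [e| |]//; rewrite ?leey// -?EFinD !lee_fin => _ _ _ _ ce ac [be].
lra.
Qed.

(** The positive part of - u ln u is u theta(u) with theta(u) = max(0, - ln u). The entropy of [f]
    is at most the integral of this part, while for the Gaussian the two are equal because its
    density is at most 1. *)
Lemma shannon_entropy_le : shannon_entropy f <= shannon_entropy gauss.
Proof.
pose theta u : R := Num.max 0%R (- ln u)%R.
have mt : measurable_fun setT theta.
  by apply: measurable_maxr => //; apply: measurableT_comp => //; exact: measurable_ln.
have t0 u : (0 <= theta u)%R by rewrite le_max lexx.
have le : \int[mu]_x (f x * theta (f x))%:E <= \int[mu]_x (gauss x * theta (gauss x))%:E.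
  apply: integral_decreasing_le => // s s0; left; exists (expR (- s)) => u u0.
  rewrite lt_max (le_gtF s0)/= -[in RHS](lnK (x := u)) ?posrE// ltr_expR.
  by rewrite ltrNr.
have gE : shannon_entropy gauss = \int[mu]_x (gauss x * theta (gauss x))%:E.
  rewrite /shannon_entropy (eq_integral (fun x => - (gauss x * theta (gauss x))%:E)).
    rewrite integral_ge0N ?oppeK// => x _.
    by rewrite lee_fin mulr_ge0.
  move=> x _; rewrite /theta max_r -?EFinN ?mulrN ?opprK// oppr_ge0 ln_le0//.
  exact: gauss_density_le1.
rewrite gE /shannon_entropy integralE.
rewrite [X in _ - X](eq_integral (fun x => (f x * theta (f x))%:E)); last first.
  move=> x _; rewrite funenegE -EFinN -EFin_max -mulrN maxC /theta.
  by rewrite -[X in Num.max X _](mulr0 (f x)) -maxr_pMr.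
have P0 : 0 <= \int[mu]_x (fun x => (f x * ln (f x))%:E)^\+ x.
  exact: integral_ge0.
have N0 : 0 <= \int[mu]_x (f x * theta (f x))%:E.
  by apply: integral_ge0 => x _; rewrite lee_fin mulr_ge0.
move: P0 N0 le; move: (\int[mu]_x (f x * theta (f x))%:E) (integral _ _ _).
move: (\int[mu]_x (gauss x * theta (gauss x))%:E).
move=> [a| |] [b| |] [c| |]//=; rewrite ?leey ?leNye ?lee_fin//=.
  by move=> c0 b0 ba; lra.
Qed.

(** For [c] above the essential supremum of [f], all the mass of [f] lies in [f < c]; by the
    comparison the Gaussian has all its mass in [gauss < c], so its essential supremum is at most
    [c]. *)
Lemma Lnormy_ge : 'N[mu]_+oo[EFin \o gauss] <= 'N[mu]_+oo[EFin \o f].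
Proof.
rewrite unlock; case: ifPn => // mu0.
have absE (h : Rn R n -> R) : (forall x, 0 <= h x)%R -> abse \o (EFin \o h) = EFin \o h.
  by move=> h0; apply/funext => x /=; rewrite ger0_norm.
rewrite !absE//.
have M0 : 0 <= ess_sup mu (EFin \o f).
  by apply: ess_sup_gee => //; apply: nearW => x; rewrite lee_fin.
have := ess_sup_ge mu (EFin \o f).
case: (ess_sup mu (EFin \o f)) M0 => [M M0 fM|_ _|]; [|by rewrite leey|by []].

apply/lee_addgt0Pr => e e0; apply/ess_supP.
(* A margin above [M], since [f] may equal [M] on a set of positive measure. *)
pose c := (M + e)%R.
have mbg : measurable_fun setT (fun x => below c (gauss x)).
  by apply: measurableT_comp mg; exact: measurable_below.
have fc : \int[mu]_x (below c (f x))%:E = 1.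
  rewrite -f1; apply: ge0_ae_eq_integral => //.
  - by apply/measurable_EFinP; apply: measurableT_comp mf; exact: measurable_below.
  - exact/measurable_EFinP.
  - by move=> x _; rewrite lee_fin below_ge0.
  - by move=> x _; rewrite lee_fin.
  apply: filterS fM => x /= fxM _.
  by rewrite /below (le_lt_trans (y := M))// ltrDl.
have gc : \int[mu]_x (below c (gauss x))%:E = 1.
  apply/eqP; rewrite eq_le -{2}fc below_le andbT -g1; apply: ge0_le_integral => //.
  - by move=> x _; rewrite lee_fin below_ge0.
  - exact/measurable_EFinP.
  - exact/measurable_EFinP.
  - by move=> x _; rewrite lee_fin /below; case: (_ < _)%R.
have d0 x : (0 <= gauss x - below c (gauss x))%R.
  by rewrite subr_ge0 /below; case: (_ < _)%R.
have md : measurable_fun setT (fun x => (gauss x - below c (gauss x))%:E).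
  by apply/measurable_EFinP; exact: measurable_funB.
have : \int[mu]_x (gauss x)%:E =
    \int[mu]_x (below c (gauss x))%:E + \int[mu]_x (gauss x - below c (gauss x))%:E.
  rewrite -ge0_integralD//.
  - by apply: eq_integral => x _; rewrite -EFinD addrC subrK.
  - by move=> x _; rewrite lee_fin below_ge0.
  - exact/measurable_EFinP.
  - by move=> x _; rewrite lee_fin.
rewrite g1 gc => dE.
have {}dE : \int[mu]_x (gauss x - below c (gauss x))%:E = 0.
  move: dE; case: (\int[mu]_x (gauss x - below c (gauss x))%:E) => // r [h].
  by congr EFin; lra.
have : ae_eq mu setT (fun x => (gauss x - below c (gauss x))%:E) (cst 0).
  apply/ae_eq_integral_abs => //; rewrite -dE.
  by apply: eq_integral => x _; rewrite gee0_abs// lee_fin.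
(* As the Gaussian density is positive, it agrees with its truncation only where it is under [c]. *)
apply: filterS => x /(_ I) /= [] /eqP; rewrite subr_eq0 /below.
case: ifPn => [gx _|_ /eqP gx0]; first by rewrite -EFinD lee_fin ltW.
by have := g0 x; rewrite gx0 ltxx.
Qed.

Lemma renyi_tsallis_entropy_le (q : \bar R) : 0 <= q ->
  renyi_entropy q f <= renyi_entropy q gauss /\
  tsallis_entropy q f <= tsallis_entropy q gauss.
Proof.
have lnele (a b : \bar R) : 0 <= a -> a <= b -> lne a <= lne b.
  move=> a0 ab; rewrite lee_lne// in_itv/= leey andbT//.
  exact: le_trans ab.
case: q => [q| |] q0; [| |by []]; rewrite /renyi_entropy /tsallis_entropy.
- case: eqVneq => [_|qn0].
    split; first by apply: lnele => //; exact: measure_support_le.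
    by apply: leeD2r; exact: measure_support_le.
  case: eqVneq => [_|qn1]; first by split; exact: shannon_entropy_le.
  have Pge0 (h : Rn R n -> R) : 0 <= \int[mu]_x (h x `^ q)%R%:E.
    by apply: integral_ge0 => x _; rewrite lee_fin powR_ge0.
  have q0' : (0 < q)%R by rewrite lt_def qn0.
  have [q1|q1] := ltP q 1%R.
    have r0 : 0 <= ((1 - q)^-1)%:E by rewrite lee_fin invr_ge0 subr_ge0 ltW.
    have le : \int[mu]_x (f x `^ q)%R%:E <= \int[mu]_x (gauss x `^ q)%R%:E.
      by apply: integral_powR_le; rewrite q0'.
    split; first exact: (lee_wpmul2r r0 (lnele _ _ (Pge0 f) le)).
    exact: (lee_wpmul2r r0 (leeD2r _ le)).
  have {}q1 : (1 < q)%R by rewrite lt_def qn1.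
  have r0 : 0 <= ((q - 1)^-1)%:E by rewrite lee_fin invr_ge0 subr_ge0 ltW.
  have le := integral_powR_ge q1.
  (* For q > 1 the factor 1/(1 - q) is negative and reverses the inequality. *)
  have flip (a b : \bar R) : b <= a -> a * ((1 - q)^-1)%:E <= b * ((1 - q)^-1)%:E.
    move=> ba; have -> : ((1 - q)^-1)%:E = - ((q - 1)^-1)%:E.
      by rewrite -opprB invrN EFinN.
    by rewrite !muleN leeN2; exact: lee_wpmul2r.
  split; first exact: (flip _ _ (lnele _ _ (Pge0 gauss) le)).
  exact: (flip _ _ (leeD2r _ le)).
- split.
    by rewrite leeN2; apply: lnele; [exact: Lnorm_ge0|exact: Lnormy_ge].
  (* Unless the entropy of [f] is -oo, its norm is at most 1, and then so is that of the Gaussian: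
     both values are 0. *)
  case: ifPn => [le1|_]; last by rewrite leNye.
  by rewrite (le_trans Lnormy_ge).
Qed.

End entropy_comparison.

(** * Strongly log-concave densities *)

Local Open Scope ereal_scope.

Theorem corollary2p8 (R : realType) (n : nat) (f : Rn R n -> R)
  (hf : strongly_log_concave f) (q : \bar R) (hq : 0 <= q) :
  renyi_entropy q f <= renyi_entropy q (@gauss_density R n) /\
  tsallis_entropy q f <= tsallis_entropy q (@gauss_density R n).
Proof.
have [fP [V [VNy Vconv] fV]] := hf.
(* Since [V] is never -oo, exp(- V) is finite; it is 0 where [V] is +oo. *)
pose W x := fine (expeR (- V x)).
have WE x : (W x)%:E = expeR (- V x).
  rewrite fineK// fin_numE gt_eqF ?(lt_le_trans _ (expeR_ge0 _)) ?ltNye//=.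
  by rewrite expeR_eqy eqe_oppLR /= VNy.
have W0 x : (0 <= W x)%R by rewrite -lee_fin WE expeR_ge0.
have WP : log_concave W.
  split=> // t x y /andP[t0 t1].
  have t1' : (1 - t)%R != 0%R by rewrite subr_eq0 gt_eqF.
  have := Vconv t x y; rewrite (ltW t0) (ltW t1) => /(_ isT).
  have := W0 (convex_comb t x y); rewrite /W.
  (* If [V] is +oo at [x] or [y], the left side vanishes, as 0 to a positive power is 0; otherwise
     convexity makes [V] finite at the combination. *)
  have := VNy x; case: (V x) => [a _|_|//]; last first.
    by rewrite /= powR0 ?gt_eqF// mul0r.
  have := VNy y; case: (V y) => [b _|_|//]; last first.
    by rewrite /= (powR0 t1') mulr0.
  have := VNy (convex_comb t x y); case: (V _) => [r _ _|//|//] /=.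
  rewrite -!EFinM -EFinD lee_fin => le.
  by rewrite -!expRM -expRD ler_expR; lra.
apply: renyi_tsallis_entropy_le => // c.
apply: (integral_below_gauss_le WP fP).
by apply: filterS fV => x; rewrite -WE -EFinM => -[].
Qed.
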